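(* Let $d\ge 1$, let $S$ be a non-empty finite set and let $X$ be a translation-invariant $S$-valued Markov random field on $\mathbb{Z}^d$. If $$\limsup_{n\to\infty}\gamma(\Lambda_n,\Lambda_{\delta n})>0\qquad\text{for some }0<\delta<1,$$ then $X$ is ffiid. If $$\liminf_{n\to\infty}\gamma(\Lambda_n,\Lambda_{\delta n})>0\qquad\text{for some }0<\delta<1,$$ then $X$ is ffiid with power-law tails.
   Context: Lattice. $\mathbb{Z}^d$ is a graph in which $u,v$ are adjacent iff $\|u-v\|_1=1$; $\partial V$ is the set of vertices at graph distance exactly $1$ from $V$; $\mathbf 0$ is the origin. For real $r>0$, $\Lambda_r:=[-r,r]^d\cap\mathbb{Z}^d$. Markov random fields. $X=(X_v)_{v\in\mathbb{Z}^d}$ takes values in the non-empty finite set $S$. It is a Markov random field if for every finite $V\subset\mathbb{Z}^d$, $(X_v)_{v\in V}$ and $(X_v)_{v\in V^c}$ are conditionally independent given $(X_v)_{v\in\partial V}$. It is translation-invariant if $(X_{v+u})_{v}$ has the same law as $X$ for every $u\in\mathbb{Z}^d$. Its topological support is $\Omega=\{x\in S^{\mathbb{Z}^d}:\Pr(X_V=x_V)>0 \text{ for all finite }V\}$, where $x_V=(x_v)_{v\in V}$. Put $\Omega_V=\{\omega_V:\omega\in\Omega\}$. For finite $V$ and $\tau\in\Omega_{\partial V}$, $P_V^\tau=\Pr(X_V\in\cdot\mid X_{\partial V}=\tau)$, and for $U\subset V$, $P^\tau_{V,U}$ is the marginal of $P^\tau_V$ on $U$. For finite $U\subset V\subset\mathbb{Z}^d$,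 $$\gamma(V,U):=\sum_{\omega\in\Omega_U}\ \min_{\tau\in\Omega_{\partial V}}P^\tau_{V,U}(\omega).$$ Codings. Let $Y=(Y_v)_{v\in\mathbb{Z}^d}$ be a translation-invariant random field with values in a measurable space $T$. A coding from $Y$ to $X$ is a measurable $\varphi:T^{\mathbb{Z}^d}\to S^{\mathbb{Z}^d}$ commuting with all translations of $\mathbb{Z}^d$ and such that $\varphi(Y)$ has the same distribution as $X$. Its coding radius $R_\varphi(y)$ at $y$ is the minimal integer $r\ge0$ such that $\varphi(y')_{\mathbf 0}=\varphi(y)_{\mathbf 0}$ for all $y'$ agreeing with $y$ on $\{v:\|v\|_1\le r\}$ ($\infty$ if none exists); $R=R_\varphi(Y)$. The coding is finitary if $R<\infty$ a.s., and has power-law tails if $\Pr(R\ge r)\le Cr^{-c}$ for some $C,c>0$ and all $r>0$. $X$ is ffiid (with power-law tails) if there is a finitary coding (with power-law tails) to $X$ from some i.i.d. process $Y=(Y_v)_{v\in\mathbb{Z}^d}$ taking values in some measurable space. *)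

(* Defs.v *)
From HB Require Import structures.
From mathcomp Require Import all_boot all_order all_algebra finmap.
From mathcomp Require Import all_classical all_reals all_analysis.

Set Implicit Arguments.
Unset Strict Implicit.
Unset Printing Implicit Defensive.

Import Order.TTheory GRing.Theory Num.Theory.

Local Open Scope classical_set_scope.
Local Open Scope ring_scope.

Notation lattice d := 'rV[int]_d.

Definition l1norm d (v : lattice d) : nat := (\sum_(i < d) `|v ord0 i|)%N.

Definition adjacent d (u v : lattice d) : bool := l1norm (u - v) == 1%N.

(* [fset_set] of an infinite set is the junk value [fset0]; [in_box] and
   [in_boundary] below show that it does not occur here. *)
Definition box d (R : realType) (r : R) : {fset lattice d} :=
  fset_set [set v : lattice d | forall i, `|(v ord0 i)%:~R| <= r].

Definition boundary d (V : {fset lattice d}) : {fset lattice d} :=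
  fset_set [set v | v \notin V /\ exists2 u, u \in V & adjacent u v].

Lemma finite_int_box d (n : nat) :
  finite_set [set v : lattice d | forall i, (`|v ord0 i| <= n)%N].
Proof.
pose f (g : {ffun 'I_d -> 'I_(n + n).+1}) : lattice d :=
  \row_i ((g i : nat)%:Z - n%:Z).
apply: (@sub_finite_set _ _ (f @` setT)); last exact/finite_image/finite_finset.
move=> v hv; have hn i : - n%:Z <= v ord0 i <= n%:Z.
  by rewrite -ler_norml -abszE lez_nat; exact: hv.
have h0 i : 0 <= v ord0 i + n%:Z.
  by have /andP[] := hn i; rewrite -subr_ge0 opprK.
have h1 i : (absz (v ord0 i + n%:Z)%R < (n + n).+1)%N.
  by rewrite ltnS -lez_nat gez0_abs // PoszD lerD2r; have /andP[] := hn i.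
exists [ffun i => Ordinal (h1 i)] => //.
by apply/rowP => i; rewrite mxE ffunE /= gez0_abs // addrK.
Qed.

Lemma in_box d (R : realType) (r : R) (v : lattice d) :
  v \in box d r <-> (forall i, `|(v ord0 i)%:~R| <= r).
Proof.
rewrite /box in_fset_set; first by rewrite inE.
apply: sub_finite_set (finite_int_box d (Num.truncn r)) => w hw i.
have r0 : 0 <= r by apply: le_trans (hw i).
rewrite truncn_ge_nat //; apply: le_trans (hw i).
by rewrite -intr_norm -abszE.
Qed.

Lemma in_boundary d (V : {fset lattice d}) (v : lattice d) :
  v \in boundary V <-> v \notin V /\ exists2 u, u \in V & adjacent u v.
Proof.
rewrite /boundary in_fset_set; first by rewrite inE.
apply: (@sub_finite_set _ _ (\bigcup_(u in [set` V])
  ((fun w => u - w) @` [set w : lattice d | forall i, (`|w ord0 i| <= 1)%N]))).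
  move=> w [_ [u uV uw]]; exists u => //; exists (u - w); last by rewrite subKr.
  move=> i; apply: leq_trans (eq_leq (eqP uw)).
  by rewrite /l1norm (bigD1 i) //= leq_addr.
apply: bigcup_finite; first exact: finite_fset.
by move=> u _; apply: finite_image; exact: finite_int_box.
Qed.

Definition translate d (S : Type) (u : lattice d) (x : lattice d -> S) :
  lattice d -> S := fun v => x (v + u).

Definition restr d (S : Type) (V : {fset lattice d}) (x : lattice d -> S) :
  {ffun V -> S} := [ffun v : V => x (val v)].

(* Product sigma-algebra on [lattice d -> S], where S carries the
   sigma-algebra G. *)
Definition product_sigma d (S : Type) (G : set (set S)) :
    set (set (lattice d -> S)) :=
  <<s [set A | exists v, exists2 B, G B & A = [set x | B (x v)]] >>.
Arguments product_sigma d {S} G.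

Definition random_field d dO (Om : measurableType dO) (S : Type)
    (G : set (set S)) (X : lattice d -> Om -> S) : Prop :=
  forall v B, G B -> measurable (X v @^-1` B).

Definition same_law (R : realType) d (S : Type) (G : set (set S))
    dO (Om : measurableType dO) (P : probability Om R) (X : lattice d -> Om -> S)
    dO' (Om' : measurableType dO') (P' : probability Om' R)
    (X' : lattice d -> Om' -> S) : Prop :=
  forall A, product_sigma d G A ->
    P [set w | A (X^~ w)] = P' [set w | A (X'^~ w)].

Definition translation_invariant (R : realType) d (S : Type) (G : set (set S))
    dO (Om : measurableType dO) (P : probability Om R)
    (X : lattice d -> Om -> S) : Prop :=
  forall u, same_law G P (fun v w => translate u (X^~ w) v) P X.

Definition cond_prob (R : realType) dO (Om : measurableType dO)
  (P : probability Om R) (A E : set Om) : R := fine (P (A `&` E)) / fine (P E).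

Section MarkovField.
Variables (R : realType) (d : nat) (dO : measure_display)
  (Om : measurableType dO) (P : probability Om R) (S : finType)
  (X : lattice d -> Om -> S).

Definition sigma_field (A : set (lattice d)) : set (set Om) :=
  <<s [set E | exists2 v, A v & exists B : set S, E = X v @^-1` B] >>.

Definition event_eq (V : {fset lattice d}) (t : {ffun V -> S}) : set Om :=
  [set w | restr V (X^~ w) = t].

(* The conditioning variable X_{boundary V} is finitely valued, so conditioning
   on it amounts to conditioning on its atoms of positive probability. *)
Definition markov_random_field : Prop :=
  forall (V : {fset lattice d}) (A B : set Om) (t : {ffun boundary V -> S}),
    sigma_field [set` V] A -> sigma_field (~` [set` V]) B ->
    (0 < P (event_eq t))%E ->
    cond_prob P (A `&` B) (event_eq t) =
    cond_prob P A (event_eq t) * cond_prob P B (event_eq t).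

Definition topological_support : set (lattice d -> S) :=
  [set x | forall V : {fset lattice d}, (0 < P (event_eq (restr V x)))%E].

Definition support_on (V : {fset lattice d}) : set {ffun V -> S} :=
  [set restr V x | x in topological_support].
Arguments support_on : clear implicits.

Definition cond_law (V : {fset lattice d}) (t : {ffun boundary V -> S})
    (A : set {ffun V -> S}) : R :=
  cond_prob P [set w | A (restr V (X^~ w))] (event_eq t).

(* Only meaningful for U included in V. *)
Definition cond_marginal (V U : {fset lattice d}) (t : {ffun boundary V -> S})
    (om : {ffun U -> S}) : R :=
  cond_law t [set eta : {ffun V -> S} |
    forall (u : U) (v : V), val u = val v -> eta v = om u].

(* The minimum is over a non-empty set of numbers in [0, 1], so the neutral
   value 1 does not affect it. *)
Definition gamma (V U : {fset lattice d}) : R :=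
  \sum_(om : {ffun U -> S} | om \in support_on U)
    \big[Order.min/1]_(t : {ffun boundary V -> S} | t \in support_on (boundary V))
      cond_marginal t om.

End MarkovField.
Arguments support_on {R d dO Om} P {S} X V.

Definition iid (R : realType) d dO (Om : measurableType dO)
    (P : probability Om R) dT (T : measurableType dT)
    (Y : lattice d -> Om -> T) : Prop :=
  [/\ random_field measurable Y,
      forall (J : {fset lattice d}) (B : lattice d -> set T),
        (forall v, measurable (B v)) ->
        P [set w | forall v, v \in J -> B v (Y v w)] =
        (\prod_(v <- J) P (Y v @^-1` B v))%E
    & forall u v (B : set T), measurable B ->
        P (Y u @^-1` B) = P (Y v @^-1` B)].

Section Coding.
Variables (R : realType) (d : nat) (S : finType).

Definition coding dT (T : measurableType dT)
    dO' (Om' : measurableType dO') (Q : probability Om' R)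
    (Y : lattice d -> Om' -> T)
    dO (Om : measurableType dO) (P : probability Om R)
    (X : lattice d -> Om -> S)
    (phi : (lattice d -> T) -> (lattice d -> S)) : Prop :=
  [/\ forall A, product_sigma d (@discrete_measurable S) A ->
        product_sigma d (@measurable _ T) (phi @^-1` A),
      forall u y, phi (translate u y) = translate u (phi y)
    & same_law (@discrete_measurable S) Q (fun v w => phi (Y^~ w) v) P X].

(* The infimum of a non-empty set of naturals is its minimum; that of the
   empty set is +oo. *)
Definition coding_radius (T : Type) (phi : (lattice d -> T) -> (lattice d -> S))
    (y : lattice d -> T) : \bar R :=
  ereal_inf [set (r%:R)%:E | r in [set r : nat |
    forall y', (forall v, (l1norm v <= r)%N -> y' v = y v) ->
      phi y' 0 = phi y 0]].

Definition finitary dT (T : measurableType dT)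
    dO' (Om' : measurableType dO') (Q : probability Om' R)
    (Y : lattice d -> Om' -> T)
    (phi : (lattice d -> T) -> (lattice d -> S)) : Prop :=
  \forall w \ae Q, (coding_radius phi (Y^~ w) < +oo)%E.

(* The coding radius need not be measurable for a general T, hence the outer
   measure; it agrees with Q on measurable events. *)
Definition power_law_tails dT (T : measurableType dT)
    dO' (Om' : measurableType dO') (Q : probability Om' R)
    (Y : lattice d -> Om' -> T)
    (phi : (lattice d -> T) -> (lattice d -> S)) : Prop :=
  exists C c : R, [/\ 0 < C, 0 < c & forall r : R, 0 < r ->
    (mu_ext Q [set w | (r%:E <= coding_radius phi (Y^~ w))%E]
       <= (C * r `^ (- c))%:E)%E].

Definition ffiid dO (Om : measurableType dO) (P : probability Om R)
    (X : lattice d -> Om -> S) : Prop :=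
  exists (dT : measure_display) (T : measurableType dT)
    (dO' : measure_display) (Om' : measurableType dO') (Q : probability Om' R)
    (Y : lattice d -> Om' -> T) (phi : (lattice d -> T) -> (lattice d -> S)),
    [/\ iid Q Y, coding Q Y P X phi & finitary Q Y phi].

Definition ffiid_power_law dO (Om : measurableType dO) (P : probability Om R)
    (X : lattice d -> Om -> S) : Prop :=
  exists (dT : measure_display) (T : measurableType dT)
    (dO' : measure_display) (Om' : measurableType dO') (Q : probability Om' R)
    (Y : lattice d -> Om' -> T) (phi : (lattice d -> T) -> (lattice d -> S)),
    [/\ iid Q Y, coding Q Y P X phi, finitary Q Y phi
      & power_law_tails Q Y phi].

End Coding.

(* Main.v *)
Require Import Defs.
From HB Require Import structures.
From mathcomp Require Import all_boot all_order all_algebra finmap.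
From mathcomp Require Import all_classical all_reals all_analysis.
From mathcomp Require Import zify ring lra.

(** The field is sampled by coupling from the past.  At each time [-s] a sparse
    random set of centres is drawn.  Around every centre that is far from all
    the others, the box of radius [n s] is resampled from its conditional law
    given its boundary.  These boxes neither overlap nor touch, so by the
    Markov property every step leaves the law of the field invariant
    ([block_inv], [step_inv], [history_inv]).

    Resampling uses one random map for all boundary conditions at once, the
    maximal coupling of the conditional laws ([coupling], [scale_coupling]):
    with probability at least [gamma] its values on the inner box do not depend
    on the boundary.  After [s] steps the value at the origin depends on the
    past only through a ball of radius [radius s], and the next scale is chosen
    so large that this ball fits into half of the inner box.  Then, with a
    probability that is bounded below, the vicinity of the origin contains a
    single centre, this ball lies in its inner box, and the random map forgets
    the boundary; from there on, the past is irrelevant ([coal_step],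
    [coal_avg_ge], [history_coal]).  Attempts at different times are independent,
    so that [t] of them fail with probability at most [q ^ t]
    ([uncoal_avg_le]), and the value at the origin is almost surely a function
    of the randomness in a finite window ([limit]).

    The dynamics started from the field itself has the law of the field at
    every time, and agrees with the limit up to probability [q ^ t]; this gives
    one inequality between the probabilities of patterns, and both families of
    probabilities sum to one ([limit_ge], [limit_prob]).  A positive upper limit
    of [gamma] provides infinitely many usable scales, hence a finitary coding.
    A positive lower limit allows scales that grow geometrically; the coding
    radius then exceeds a multiple of [K ^ t] with probability at most [q ^ t],
    which is a power law ([power_law_of_tails]).

    The randomness is a family of independent integer variables of finite
    range.  All expectations are finite iterated sums ([avg]); the family itself
    lives on the unit interval ([indep_family]). *)

Set Implicit Arguments.
Unset Strict Implicit.
Unset Printing Implicit Defensive.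

Import Order.TTheory GRing.Theory Num.Theory.
Import numFieldNormedType.Exports.

Local Open Scope classical_set_scope.
Local Open Scope ring_scope.

(** * Averages over independent coordinates *)

Lemma perm_filter_cat (T : eqType) (K K' : seq T) : uniq K -> uniq K' ->
  {subset K <= K'} -> perm_eq K' ([seq i <- K' | i \notin K] ++ K).
Proof.
move=> uK uK' sK; apply: uniq_perm => //.
  rewrite cat_uniq filter_uniq //= uK andbT.
  by apply/hasPn => i iK; rewrite mem_filter /= iK.
move=> i; rewrite mem_cat mem_filter; case: (boolP (i \in K)) => [/sK->|_] //.
by rewrite orbF.
Qed.

Section Average.
Variables (R : realType) (I : choiceType) (N : I -> nat) (mu : I -> nat -> R).

Definition upd (z : I -> nat) (i : I) (a : nat) : I -> nat :=
  fun j => if j == i then a else z j.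

(** Integration over independent variables of finite range, one coordinate at a
    time and with the other coordinates frozen: independence then amounts to
    rearranging lists of coordinates. *)
Fixpoint avg (K : seq I) (h : (I -> nat) -> R) (z : I -> nat) : R :=
  if K is i :: K' then \sum_(a < N i) mu i a * avg K' h (upd z i a) else h z.

Definition depends (T : Type) (K : pred I) (h : (I -> nat) -> T) :=
  forall z z', (forall i, K i -> z i = z' i) -> h z = h z'.

Definition is_law := forall i, (forall a, 0 <= mu i a) /\ \sum_(a < N i) mu i a = 1.

Lemma upd_same z i a : upd z i a i = a. Proof. by rewrite /upd eqxx. Qed.

Lemma upd_other z i a j : j != i -> upd z i a j = z j.
Proof. by rewrite /upd => /negPf->. Qed.

Lemma updC z i j a b : i != j -> upd (upd z i a) j b = upd (upd z j b) i a.
Proof.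
move=> ij; apply/funext => k; rewrite /upd.
by case: (eqVneq k j) => // ->; rewrite eq_sym (negPf ij).
Qed.

Lemma depends_sub (T : Type) (K K' : pred I) (h : (I -> nat) -> T) :
  (forall i, K i -> K' i) -> depends K h -> depends K' h.
Proof. by move=> s hh z z' e; apply: hh => i /s; exact: e. Qed.

Lemma avg_cat K K' h z : avg (K ++ K') h z = avg K (avg K' h) z.
Proof. by elim: K z => //= i K IH z; apply: eq_bigr => a _; rewrite IH. Qed.

Lemma eq_avg K h h' z : (forall z', (forall i, i \notin K -> z' i = z i) -> h z' = h' z') ->
  avg K h z = avg K h' z.
Proof.
elim: K z => /= [|i K IH] z e; first exact: e.
apply: eq_bigr => a _; congr (_ * _); apply: IH => z' e'; apply: e => j.
by rewrite inE negb_or => /andP[ji jK]; rewrite e' // upd_other.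
Qed.

Lemma avg_lin K (J : Type) (r : seq J) (c : J -> R) (h : J -> (I -> nat) -> R) z :
  avg K (fun z => \sum_(j <- r) c j * h j z) z = \sum_(j <- r) c j * avg K (h j) z.
Proof.
elim: K z => //= i K IH z.
under eq_bigr do rewrite IH mulr_sumr.
rewrite exchange_big; apply: eq_bigr => j _; rewrite mulr_sumr.
by apply: eq_bigr => a _; rewrite mulrCA.
Qed.

Lemma avg_scale K c h z : avg K (fun z => c * h z) z = c * avg K h z.
Proof.
have := avg_lin K [:: tt] (fun=> c) (fun=> h) z; rewrite big_seq1 => <-.
by apply: eq_avg => z' _; rewrite big_seq1.
Qed.

Lemma avg_sum K (J : Type) (r : seq J) (h : J -> (I -> nat) -> R) z :
  avg K (fun z => \sum_(j <- r) h j z) z = \sum_(j <- r) avg K (h j) z.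
Proof.
under [RHS]eq_bigr do rewrite -[avg _ _ _]mul1r.
rewrite -avg_lin; apply: eq_avg => z' _.
by apply: eq_bigr => j _; rewrite mul1r.
Qed.

Lemma avg_sub K h h' z : avg K (fun z => h z - h' z) z = avg K h z - avg K h' z.
Proof.
elim: K z => //= i K IH z; rewrite -sumrB.
by apply: eq_bigr => a _; rewrite IH mulrBr.
Qed.

Lemma avg_swap i j K h z : avg [:: i, j & K] h z = avg [:: j, i & K] h z.
Proof.
have [->//|ij] := eqVneq i j.
rewrite /=; under eq_bigr do rewrite mulr_sumr.
rewrite exchange_big; apply: eq_bigr => b _; rewrite mulr_sumr.
by apply: eq_bigr => a _; rewrite mulrCA updC.
Qed.

Lemma avg_move i K1 K2 h z : avg (K1 ++ i :: K2) h z = avg (i :: K1 ++ K2) h z.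
Proof.
elim: K1 z => // j K1 IH z; rewrite avg_swap [in RHS]/=.
by rewrite [LHS]/=; apply: eq_bigr => a _; rewrite IH.
Qed.

Lemma avg_perm K K' h z : perm_eq K K' -> avg K h z = avg K' h z.
Proof.
elim: K K' z => [|i K IH] K' z; first by rewrite perm_sym => /perm_nilP ->.
move=> KK'; have iK' : i \in K' by rewrite -(perm_mem KK') mem_head.
case/splitPr: iK' KK' => K1 K2 KK'; rewrite avg_move /=.
apply: eq_bigr => a _; congr (_ * _); apply: IH.
rewrite -(perm_cons i) (perm_trans KK') //.
by rewrite -cat1s perm_catCA.
Qed.

Hypothesis lawP : is_law.

(** Updating [i] does not change [h], and the weights at [i] sum to one. *)
Lemma avg_indep i K h z : depends (fun j => j != i) h ->
  avg (i :: K) h z = avg K h z.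
Proof.
move=> hi; suff E : forall K z a, avg K h (upd z i a) = avg K h z.
  by rewrite /=; under eq_bigr do rewrite E; rewrite -mulr_suml (lawP i).2 mul1r.
move=> {K z}; elim=> /= [|j K IH] z a.
  by apply: hi => j ji; rewrite upd_other.
apply: eq_bigr => b _; congr (_ * _).
have [->|ij] := eqVneq i j; last by rewrite updC.
by congr (avg _ _); apply/funext => k; rewrite /upd; case: eqP.
Qed.

Lemma avg_const K c z : avg K (fun=> c) z = c.
Proof.
by elim: K z => //= i K IH z; under eq_bigr do rewrite IH; rewrite -mulr_suml (lawP i).2 mul1r.
Qed.

Lemma avg_mono K h h' z : (forall z, h z <= h' z) -> avg K h z <= avg K h' z.
Proof.
move=> hh; elim: K z => //= i K IH z; apply: ler_sum => a _.
by rewrite ler_wpM2l // (lawP i).1.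
Qed.

Lemma avg_depends (D : pred I) K h :
  depends D h -> depends (fun i => D i && (i \notin K)) (avg K h).
Proof.
elim: K => /= [|i K IH] hD z z' e; first by apply: hD => i Di; apply: e; rewrite Di.
apply: eq_bigr => a _; congr (_ * _); apply: IH => // j /andP[Dj jK].
rewrite /upd; case: eqVneq => // ji; apply: e; rewrite Dj inE negb_or ji.
exact: jK.
Qed.

(** Coordinates on which the function does not depend integrate to one. *)
Lemma avg_sup (K K' : seq I) h z : uniq K -> uniq K' -> {subset K <= K'} ->
  depends (mem K) h -> avg K' h z = avg K h z.
Proof.
move=> uK uK' sK hK.
have /avg_perm-> := perm_filter_cat uK uK' sK.
have : all (fun i => i \notin K) [seq i <- K' | i \notin K] by exact: filter_all.
elim: [seq _ <- _ | _] => //= i K2 IH /andP[iK K2K].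
rewrite -[LHS]/(avg (i :: (K2 ++ K)) h z) avg_indep ?IH //.
by apply: depends_sub hK => j jK; apply: contraNneq iK => <-.
Qed.

Lemma avg_prod (K : seq I) (g : I -> nat -> R) z : uniq K ->
  avg K (fun z => \prod_(i <- K) g i (z i)) z =
  \prod_(i <- K) \sum_(a < N i) mu i a * g i a.
Proof.
elim: K z => [|i K IH] z /=; first by rewrite !big_nil.
move=> /andP[iK uK]; rewrite big_cons mulr_suml; apply: eq_bigr => a _.
rewrite -mulrA; congr (_ * _); rewrite -(IH z) // -avg_scale.
transitivity (avg K (fun z => g i a * \prod_(j <- K) g j (z j)) (upd z i a)).
  by apply: eq_avg => z' e; rewrite big_cons (e i iK) upd_same.
rewrite !avg_scale; congr (_ * _).
by rewrite !IH.
Qed.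

End Average.

Lemma avg_map (R : realType) (I J : choiceType) (f : I -> J) N mu N' mu' (K : seq I)
   (h : (I -> nat) -> R) (z : J -> nat) : injective f ->
  (forall i, N' (f i) = N i) -> (forall i, mu' (f i) = mu i) ->
  avg N' mu' (map f K) (fun y => h (y \o f)) z = avg N mu K h (z \o f).
Proof.
move=> fI hN hmu; elim: K z => //= i K IH z.
rewrite hN hmu; apply: eq_bigr => a _; congr (_ * _).
rewrite IH; congr (avg _ _ _ _ _); apply/funext => j; rewrite /upd /=.
by rewrite (inj_eq fI).
Qed.

(** * Independent variables from a uniform point *)

Section Digit.
Variables (R : realType) (n : nat) (w : nat -> R).
Hypotheses (w0 : forall a, 0 <= w a) (w1 : \sum_(a < n) w a = 1).

Definition cum a := \sum_(b < a) w b.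

Definition digit (s : R) : nat := find (fun a => s < cum a.+1) (iota 0 n).

Definition remainder (s : R) : R := (s - cum (digit s)) / w (digit s).

Lemma cumS a : cum a.+1 = cum a + w a.
Proof. by rewrite /cum big_ord_recr. Qed.

Lemma cum_mono a b : (a <= b)%N -> cum a <= cum b.
Proof.
move=> /subnKC <-; elim: (b - a)%N => [|k IH]; first by rewrite addn0.
by rewrite addnS cumS (le_trans IH) // lerDl.
Qed.

Lemma digit_lt s : s < 1 -> (digit s < n)%N.
Proof.
move=> s1; rewrite /digit -[X in (_ < X)%N](size_iota 0 n) -has_find.
case: n w1 => [|m] wm; first by rewrite big_ord0 in wm; have := oner_neq0 R; rewrite -wm eqxx.
apply/hasP; exists m; first by rewrite mem_iota /= add0n ltnS leqnn.
by rewrite /cum wm.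
Qed.

Lemma digitE s a : 0 <= s < 1 -> (digit s == a) = (a < n)%N && (cum a <= s < cum a.+1).
Proof.
move=> /andP[s0 s1]; have dn := digit_lt s1.
have hs : has (fun a => s < cum a.+1) (iota 0 n) by rewrite has_find size_iota.
have lts : s < cum (digit s).+1.
  by have := nth_find 0 hs; rewrite -/(digit s) nth_iota // add0n.
have ges b : (b < digit s)%N -> cum b.+1 <= s.
  move=> bd; have := before_find 0 bd; rewrite nth_iota ?add0n.
    by move/negbT; rewrite -leNgt.
  exact: ltn_trans bd dn.
apply/eqP/idP => [<-|/andP[an /andP[h1 h2]]].
  rewrite dn lts andbT /=; case E : (digit s) => [|b]; first by rewrite /cum big_ord0.
  by apply: ges; rewrite E.
case: (ltngtP (digit s) a) => // [da|ad].
  by have := lt_le_trans lts (cum_mono da); rewrite ltNge h1.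
by have := ges _ ad; rewrite leNgt h2.
Qed.

Lemma digit_weight s : 0 <= s < 1 -> 0 < w (digit s).
Proof.
move=> s01; have := digitE (digit s) s01; rewrite eqxx => /esym/andP[_ /andP[h1 h2]].
by have := le_lt_trans h1 h2; rewrite cumS ltrDl.
Qed.

Lemma remainder_itv s : 0 <= s < 1 -> 0 <= remainder s < 1.
Proof.
move=> s01; have wp := digit_weight s01.
have := digitE (digit s) s01; rewrite eqxx => /esym/andP[_ /andP[h1 h2]].
apply/andP; split; first by rewrite divr_ge0 ?subr_ge0 // ltW.
by rewrite /remainder ltr_pdivrMr // mul1r ltrBlDl -cumS.
Qed.

(** The points with a given digit form an interval, which the remainder rescales
    affinely to [0, 1); subintervals of remainders are thus subintervals of it. *)
Lemma digit_remainderE s a (l u : R) : 0 <= s < 1 -> (a < n)%N ->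
  0 <= l -> l <= u -> u <= 1 ->
  (digit s == a) && (l <= remainder s < u) =
  (cum a + w a * l <= s < cum a + w a * u).
Proof.
move=> s01 an l0 lu u1.
have [wa0|wa] := eqVneq (w a) 0.
  rewrite wa0 !mul0r addr0; case: (eqVneq (digit s) a) => [da|_] /=.
    by have := digit_weight s01; rewrite da wa0 ltxx.
  by apply/esym/negbTE/negP => /andP[h1 h2]; have := le_lt_trans h1 h2; rewrite ltxx.
have wp : 0 < w a by rewrite lt_def wa w0.
have wu : w a * u <= w a by rewrite -[leRHS]mulr1 ler_wpM2l.
have wl : 0 <= w a * l by rewrite mulr_ge0.
case: (eqVneq (digit s) a) => [da|da] /=.
  rewrite /remainder da ler_pdivlMr // ltr_pdivrMr // lerBrDl ltrBlDl.
  by rewrite ![_ * w a]mulrC.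
apply/esym/negbTE/negP => /andP[h1 h2]; move/negP: da; apply.
rewrite digitE // an /=; apply/andP; split.
  by apply: le_trans h1; rewrite lerDl.
by apply: (lt_le_trans h2); rewrite cumS lerD2l.
Qed.

End Digit.

Section Digits.
Variables (R : realType) (N : nat -> nat) (mu : nat -> nat -> R).
Hypothesis lawP : is_law N mu.

Let mu0 k a : 0 <= mu k a. Proof. by have [] := lawP k. Qed.
Let mu1 k : \sum_(a < N k) mu k a = 1. Proof. by have [] := lawP k. Qed.

(** The points outside [0, 1) form a null set; they are sent to 0. *)
Fixpoint state (k : nat) (x : R) : R :=
  if k is j.+1 then remainder (N j) (mu j) (state j x)
  else if 0 <= x < 1 then x else 0.

Definition digits (k : nat) (x : R) : nat := digit (N k) (mu k) (state k x).

Lemma state_itv k x : 0 <= state k x < 1.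
Proof.
elim: k => [|k IH] /=; last exact: remainder_itv.
by case: ifP => // _; rewrite lexx ltr01.
Qed.

Lemma digits_lt k x : (digits k x < N k)%N.
Proof. by apply: digit_lt => //; have /andP[] := state_itv k x. Qed.

(** Iterating the rescaling step: the points with prescribed first digits form an
    interval, whose length is the product of the weights of these digits. *)
Lemma cylinder_itv (a : nat -> nat) n : (forall k, (k < n)%N -> (a k < N k)%N) ->
  exists L : R, [/\ 0 <= L, L + \prod_(k < n) mu k (a k) <= 1 &
  forall l u, 0 <= l -> l <= u -> u <= 1 ->
  forall x, 0 <= x < 1 ->
   (forall k, (k < n)%N -> digits k x = a k) /\ l <= state n x < u <->
   L + (\prod_(k < n) mu k (a k)) * l <= x < L + (\prod_(k < n) mu k (a k)) * u].
Proof.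
elim: n => [|n IH] an.
  exists 0; rewrite big_ord0 add0r; split=> // l u l0 lu u1 x x01.
  by rewrite !mul1r !add0r /= x01; split=> [[]|].
case: IH => [k kn|L [L0 L1 HL]]; first by apply: an; rewrite ltnW.
have an' := an n (ltnSn n).
exists (L + (\prod_(k < n) mu k (a k)) * cum (mu n) (a n)).
have p0 : 0 <= \prod_(k < n) mu k (a k) by apply: prodr_ge0.
have c0 : 0 <= cum (mu n) (a n) by apply: sumr_ge0.
have cS : cum (mu n) (a n).+1 <= 1.
  by rewrite -(mu1 n); apply: (@cum_mono _ (mu n) _ (a n).+1 (N n)).
split; first by rewrite addr_ge0 ?mulr_ge0.
  rewrite big_ord_recr /= -addrA -mulrDr -cumS (le_trans _ L1) // lerD2l.
  by rewrite -[leRHS]mulr1 ler_wpM2l.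
move=> l u l0 lu u1 x x01.
rewrite big_ord_recr /= -!addrA -!mulrA -!mulrDr.
have := HL (cum (mu n) (a n) + mu n (a n) * l) (cum (mu n) (a n) + mu n (a n) * u).
move=> /(_ _ _ _ x x01) <-.
- rewrite -(@digit_remainderE _ (N n) (mu n)) ?state_itv //.
  split=> [[h1 h2]|[h1 /andP[/eqP h2 h3]]].
    split; first by move=> k kn; apply: h1; rewrite ltnW.
    by rewrite h2 andbT; apply/eqP; exact: h1.
  split=> // k; rewrite ltnS leq_eqVlt => /orP[/eqP->//|]; exact: h1.
- by rewrite addr_ge0 ?mulr_ge0.
- by rewrite lerD2l ler_wpM2l.
- by apply: le_trans cS; rewrite cumS lerD2l -[leRHS]mulr1 ler_wpM2l.
Qed.

Definition unitP : probability _ R := uniform_prob (@ltr01 R).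

Lemma unitP_itv (l u : R) : 0 <= l -> l <= u -> u <= 1 ->
  unitP `[l, u[%classic = (u - l)%:E.
Proof.
move=> l0 lu u1; rewrite /unitP /= /uniform_prob.
rewrite (eq_integral (fun=> 1%:E)); last first.
  move=> x; rewrite inE /= in_itv /= /uniform_pdf => /andP[lx xu].
  by rewrite (le_trans l0 lx) (le_trans (ltW xu) u1) subr0 invr1.
rewrite integral_cst //= mul1e lebesgue_measure_itv /= lte_fin.
have [_|ul] := ltP l u; first by rewrite EFinB.
by rewrite (le_anti (introT andP (conj lu ul))) subrr.
Qed.

(** The digits are constant outside [0, 1), so that the part of [A] there is
    either empty or a fixed null set. *)
Lemma measurable_out (A : set R) (b : Prop) :
  measurable (A `&` `[0, 1[%classic) ->
  (forall x, ~ (0 <= x < 1) -> A x = b) ->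
  measurable A /\ unitP A = unitP (A `&` `[0, 1[%classic).
Proof.
move=> mA Ab.
have mAC : measurable (A `&` ~` `[0, 1[%classic).
  have [hb|hb] := pselect b.
    rewrite (_ : _ `&` _ = ~` `[0, 1[%classic); first exact: measurableC.
    apply/seteqP; split=> x; first by case.
    by move=> hx; split=> //; rewrite Ab // => xx; apply: hx; rewrite /= in_itv.
  rewrite (_ : _ `&` _ = set0) //; apply/seteqP; split=> x // -[Ax].
  by rewrite /= in_itv /= => xx; rewrite Ab in Ax.
have U : A = (A `&` `[0, 1[%classic) `|` (A `&` ~` `[0, 1[%classic).
  by rewrite -setIUr setUv setIT.
split; first by rewrite U; apply: measurableU.
rewrite [in LHS]U measureU //; last first.
  by rewrite setIACA setICr setI0.
rewrite -[RHS]adde0; congr (_ + _)%E; apply/eqP; rewrite eq_le measure_ge0 andbT.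
apply: (@le_trans _ _ (unitP (~` `[0, 1[%classic))).
  by apply: le_measure; rewrite ?inE; [exact: mAC|exact: measurableC|exact: subIsetr].
rewrite probability_setC // unitP_itv ?lexx ?ler01 // subr0.
by rewrite subee.
Qed.

Lemma digits_out k x : ~ (0 <= x < 1) -> digits k x = digits k 1.
Proof.
move=> hx; rewrite /digits; suff -> : state k x = state k 1 by [].
elim: k => [|k /= -> //] /=; rewrite ltxx andbF.
by case: ifP.
Qed.

Lemma cylinder_prob (a : nat -> nat) n : (forall k, (k < n)%N -> (a k < N k)%N) ->
  measurable [set x | forall k, (k < n)%N -> digits k x = a k] /\
  unitP [set x | forall k, (k < n)%N -> digits k x = a k] =
    (\prod_(k < n) mu k (a k))%:E.
Proof.
move=> an; set A := [set x | _]; have [L [L0 L1 HL]] := cylinder_itv an.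
set p := \prod_(k < n) mu k (a k).
have p0 : 0 <= p by apply: prodr_ge0.
have E x : 0 <= x < 1 -> (A x <-> L <= x < L + p).
  move=> x01; have := HL 0 1 (lexx _) ler01 (lexx _) x x01.
  rewrite -/p mulr0 addr0 mulr1 => <-; split=> [Ax|[]//].
  by split=> //; exact: state_itv.
have AE : A `&` `[0, 1[%classic = `[L, L + p[%classic `&` `[0, 1[%classic.
  apply/seteqP; split=> x [h1]; rewrite /= in_itv /= => x01; split; rewrite ?in_itv //=.
    by apply/(E x x01).
  by apply/(E x x01); move: h1; rewrite /= in_itv.
have mA1 : measurable (A `&` `[0, 1[%classic) by rewrite AE; apply: measurableI.
have Aout x : ~ (0 <= x < 1) -> A x = forall k, (k < n)%N -> digits k 1 = a k.
  move=> hx; apply/propext; split=> h k kn.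
    by rewrite -(digits_out k hx) h.
  by rewrite (digits_out k hx) h.
have [mA QA] := measurable_out mA1 Aout.
split=> //; rewrite QA AE.
have [p00|pn0] := eqVneq p 0.
  rewrite p00 addr0 set_itvco0 set0I measure0 //.
have pp : 0 < p by rewrite lt_def pn0.
have sub : `[L, L + p[%classic `<=` `[0, 1[%classic.
  move=> x; rewrite /= !in_itv /= => /andP[h1 h2].
  by rewrite (le_trans L0 h1) (lt_le_trans h2 L1).
rewrite (setIidl sub) unitP_itv ?lerDl //.
by rewrite addrAC subrr add0r.
Qed.

(** The event is split according to the digits in increasing order until all the
    digits that it depends on are prescribed. *)
Lemma iota_avg (A : set (nat -> nat)) n j a : depends (fun i => (i < n)%N) A ->
  (j <= n)%N -> (forall k, (k < j)%N -> (a k < N k)%N) ->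
  let E := [set x | (forall k, (k < j)%N -> digits k x = a k) /\ A (digits^~ x)] in
  measurable E /\
  unitP E = ((\prod_(k < j) mu k (a k)) *
    avg N mu (iota j (n - j)) (fun z => (`[< A z >])%:R) a)%:E.
Proof.
move=> hA jn; move Em : (n - j)%N => m; elim: m j Em jn a => [|m IH] j Em jn a an /=.
  have nj : n = j by lia.
  have [Aa|nAa] := asboolP (A a).
    rewrite mulr1 (_ : [set _ | _] = [set x | forall k, (k < j)%N -> digits k x = a k]).
      exact: cylinder_prob.
    apply/seteqP; split=> x /=; first by case.
    move=> h; split=> //; rewrite (hA _ a) // => i; rewrite nj; exact: h.
  rewrite mulr0 (_ : [set _ | _] = set0) ?measure0 //.
  apply/seteqP; split=> x //= [h]; rewrite (hA _ a) // => i; rewrite nj; exact: h.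
have jn' : (j < n)%N by lia.
pose F b := [set x | (forall k, (k < j.+1)%N -> digits k x = upd a j b k) /\ A (digits^~ x)].
have FE b : (b < N j)%N -> measurable (F b) /\
    unitP (F b) = ((\prod_(k < j.+1) mu k (upd a j b k)) *
    avg N mu (iota j.+1 m) (fun z => (`[< A z >])%:R) (upd a j b))%:E.
  move=> bN; apply: IH => //; first by lia.
  move=> k; rewrite ltnS leq_eqVlt => /orP[/eqP->|kj]; first by rewrite upd_same.
  by rewrite upd_other ?an // ltn_eqF.
have Fj b x : F b x -> digits j x = b by move=> [/(_ j (ltnSn j))]; rewrite upd_same.
have mF b : measurable (F b).
  have [bN|Nb] := ltnP b (N j); first exact: (FE b bN).1.
  rewrite (_ : F b = set0) //; apply/seteqP; split=> x // /Fj xb.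
  by have := digits_lt j x; rewrite xb ltnNge Nb.
have -> : [set x | (forall k, (k < j)%N -> digits k x = a k) /\ A (digits^~ x)] =
    \big[setU/set0]_(b < N j) F b.
  rewrite -bigcup_mkord; apply/seteqP; split=> x /=.
    move=> [h1 h2]; exists (digits j x); first exact: digits_lt.
    split=> // k; rewrite ltnS leq_eqVlt => /orP[/eqP->|kj]; first by rewrite upd_same.
    by rewrite upd_other ?ltn_eqF // h1.
  move=> [b /= bN [h1 h2]]; split=> // k kj.
  have kj' : (k < j.+1)%N by exact: ltnW.
  by rewrite (h1 k kj') upd_other // ltn_eqF.
split; first exact: bigsetU_measurable.
have tF : trivIset setT F by move=> b c _ _ [x [/Fj <- /Fj <-]].
rewrite (measure_bigsetU (unitP) mF tF) //.
rewrite (eq_bigr (fun b : 'I_(N j) => ((\prod_(k < j) mu k (a k)) * (mu j b *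
    avg N mu (iota j.+1 m) (fun z => (`[< A z >])%:R) (upd a j b)))%:E)); last first.
  move=> b _; apply: (etrans (FE b (ltn_ord b)).2); congr EFin.
  rewrite big_ord_recr /= upd_same -mulrA; congr (_ * _).
  by apply: eq_bigr => k _; rewrite upd_other // ltn_eqF.
by rewrite sumEFin mulr_sumr.
Qed.

Lemma digits_prob (A : set (nat -> nat)) (K : seq nat) z : uniq K ->
  depends (mem K) A ->
  measurable [set x | A (digits^~ x)] /\
  unitP [set x | A (digits^~ x)] = (avg N mu K (fun z => (`[< A z >])%:R) z)%:E.
Proof.
move=> uK hA; pose n := (\max_(i <- K) i).+1.
have sK : {subset K <= iota 0 n}.
  by move=> i iK; rewrite mem_iota /= add0n ltnS (@leq_bigmax_seq _ _ xpredT (fun i => i)).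
have hA' : depends (fun i => (i < n)%N) A.
  by apply: depends_sub hA => i /sK; rewrite mem_iota.
have [//|] := @iota_avg A n 0 z hA' (leq0n _).
rewrite (_ : [set _ | _] = [set x | A (digits^~ x)]); last first.
  by apply/seteqP; split=> x //= [].
move=> mA ->; split=> //; rewrite big_ord0 mul1r subn0; congr EFin.
apply: avg_sup => //; first exact: iota_uniq.
by move=> x y e; rewrite (hA x y).
Qed.

End Digits.

(** The digits of a uniform point in a mixed radix system are independent, and the
    [k]-th one has law [mu k] if intervals are subdivided in these proportions. *)
Lemma indep_family (R : realType) (I : countType) (N : I -> nat)
    (mu : I -> nat -> R) : is_law N mu ->
  exists Z : I -> R -> nat,
  forall (A : set (I -> nat)) (K : seq I) (z : I -> nat), uniq K ->
    depends (mem K) A ->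
    measurable [set x | A (Z^~ x)] /\
    unitP R [set x | A (Z^~ x)] = (avg N mu K (fun z => (`[< A z >])%:R) z)%:E.
Proof.
move=> lawP.
(* Numbers that encode no index get a constant variable. *)
pose N' k := if pickle_inv k is Some i then N i else 1%N.
pose mu' k := if pickle_inv k is Some i then mu i else fun=> 1.
have lawP' : is_law N' mu'.
  move=> k; rewrite /N' /mu'; case: (pickle_inv k) => [i|]; first exact: lawP.
  by split=> // ; rewrite big_ord1.
exists (fun i : I => digits N' mu' (choice.pickle i)) => A K z uK hA.
pose pl (y : nat -> nat) : I -> nat := fun i => y (choice.pickle i).
pose y : nat -> nat := fun k => if pickle_inv k is Some i then z i else 0%N.
have zy : z = pl y by apply/funext => i; rewrite /pl /y pickleK_inv.
have avgE h : avg N mu K h z = avg N' mu' (map choice.pickle K) (fun y => h (pl y)) y.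
  rewrite zy -(@avg_map R I nat choice.pickle N mu N' mu' K h y (pcan_inj pickleK_inv)) // => i.
    by rewrite /N' pickleK_inv.
  by rewrite /mu' pickleK_inv.
rewrite avgE; apply: (digits_prob lawP' y (A := fun y => A (pl y))).
  by rewrite map_inj_uniq //; exact: pcan_inj pickleK_inv.
move=> y1 y2 e; apply: hA => i iK; apply: e; exact: map_f.
Qed.

(** * Simultaneous coupling of finitely many laws *)

Section Coupling.
Variables (R : realType) (T H G : finType) (pi : H -> G) (kap : T -> H -> R).
Hypotheses (kap0 : forall t h, 0 <= kap t h)
  (kap1 : forall t, \sum_h kap t h = 1).

Let q t o := \sum_(h | pi h == o) kap t h.

Definition overlap (o : G) : R :=
  \big[Order.min/1]_(t : T) \sum_(h | pi h == o) kap t h.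

Let q0 t o : 0 <= q t o. Proof. exact: sumr_ge0. Qed.

Lemma overlap_ge0 o : 0 <= overlap o.
Proof.
by apply/bigmin_geP; split=> [|t _]; [exact: ler01|exact: sumr_ge0].
Qed.

Lemma overlap_le t o : overlap o <= q t o.
Proof. exact: bigmin_le_cond. Qed.

Lemma sum_overlap_le1 (t : T) : \sum_o overlap o <= 1.
Proof.
rewrite -(kap1 t) (partition_big pi xpredT) //=.
by apply: ler_sum => o _; exact: overlap_le.
Qed.

Let mix (c : option G) : R :=
  if c is Some o then overlap o else 1 - \sum_o overlap o.

(** Given the agreed value, each law is conditioned on it; otherwise the residual
    of each law is used.  Cases of probability zero get an arbitrary law. *)
Let comp (c : option G) (t : T) (h : H) : R :=
  match c with
  | Some o => if q t o == 0 then kap t h else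
              if pi h == o then kap t h / q t o else 0
  | None => if \sum_o overlap o == 1 then kap t h else
            kap t h * (1 - overlap (pi h) / q t (pi h)) / (1 - \sum_o overlap o)
  end.

Let kapq0 t h : q t (pi h) = 0 -> kap t h = 0.
Proof.
move=> /eqP; rewrite /q psumr_eq0 // => /allP/(_ h (mem_index_enum _)).
by rewrite eqxx => /eqP.
Qed.

Let overlapq0 t o : q t o = 0 -> overlap o = 0.
Proof.
by move=> qt; apply/eqP; rewrite eq_le overlap_ge0 andbT -qt overlap_le.
Qed.

Let kap_ratio t o : \sum_(h | pi h == o) kap t h * (overlap (pi h) / q t (pi h)) = overlap o.
Proof.
rewrite (eq_bigr (fun h => kap t h * (overlap o / q t o))); last by move=> h /eqP->.
rewrite -mulr_suml -/(q t o); have [/[dup] /overlapq0 -> ->|qt] := eqVneq (q t o) 0.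
  by rewrite mul0r.
by rewrite mulrCA divff ?mulr1.
Qed.

Let residual_ge0 t h : 0 <= kap t h * (1 - overlap (pi h) / q t (pi h)).
Proof.
have [q00|qn0] := eqVneq (q t (pi h)) 0; first by rewrite kapq0 ?mul0r.
have qp : 0 < q t (pi h) by rewrite lt_def qn0 q0.
by rewrite mulr_ge0 // subr_ge0 ler_pdivrMr // mul1r overlap_le.
Qed.

Let sum_residual t : \sum_h kap t h * (1 - overlap (pi h) / q t (pi h)) = 1 - \sum_o overlap o.
Proof.
under eq_bigr do rewrite mulrBr mulr1.
rewrite sumrB kap1; congr (_ - _).
rewrite (partition_big pi xpredT) //=.
by apply: eq_bigr => o _; rewrite kap_ratio.
Qed.

Let comp_ge0 c t h : 0 <= comp c t h.
Proof.
case: c => [v|] /=.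
  by case: eqP => [//|_]; case: eqP => [_|//]; rewrite divr_ge0.
case: eqP => [//|_]; apply: divr_ge0; first exact: residual_ge0.
by rewrite subr_ge0 (sum_overlap_le1 t).
Qed.

Let comp_sum1 c t : \sum_h comp c t h = 1.
Proof.
case: c => [v|] /=.
  case: eqP => // /eqP qn; rewrite -big_mkcond /= -mulr_suml.
  exact: divff.
case: eqP => // gn; rewrite -mulr_suml sum_residual divff //.
by rewrite subr_eq0 eq_sym; apply/eqP.
Qed.

Let mix_ge0 (t : T) c : 0 <= mix c.
Proof.
by case: c => [v|] /=; rewrite ?overlap_ge0 // subr_ge0 (sum_overlap_le1 t).
Qed.

Let mixE (f : option G -> R) : \sum_c f c = f None + \sum_o f (Some o).
Proof.
rewrite (bigD1 None) //= (reindex_omap Some id) /=; last by case.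
by congr (_ + _); apply: eq_bigl => o; rewrite /= eqxx.
Qed.

Let sum_mix : \sum_c mix c = 1.
Proof. by rewrite mixE /= subrK. Qed.

Let mix_comp t h : \sum_c mix c * comp c t h = kap t h.
Proof.
rewrite mixE.
have -> : \sum_o mix (Some o) * comp (Some o) t h =
    overlap (pi h) * comp (Some (pi h)) t h.
  rewrite (bigD1 (pi h)) //= big1 ?addr0 // => o oh.
   case: (eqVneq (q t o) 0) => [/overlapq0->|_]; first by rewrite mul0r.
  by rewrite eq_sym (negPf oh) mulr0.
rewrite /=.
have -> : overlap (pi h) * (if q t (pi h) == 0 then kap t h else
    if pi h == pi h then kap t h / q t (pi h) else 0) =
    kap t h * (overlap (pi h) / q t (pi h)).
  rewrite eqxx; have [/[dup] /overlapq0 -> ->|_] := eqVneq (q t (pi h)) 0.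
    by rewrite !mul0r mulr0.
  by rewrite mulrCA mulrA.
have -> : (1 - \sum_o overlap o) * (if \sum_o overlap o == 1 then kap t h else
    kap t h * (1 - overlap (pi h) / q t (pi h)) / (1 - \sum_o overlap o)) =
    kap t h * (1 - overlap (pi h) / q t (pi h)).
  case: eqP => [g1|/eqP g1]; last by rewrite mulrC divfK // subr_eq0 eq_sym.
  have /eqP := sum_residual t; rewrite g1 subrr psumr_eq0 ?mul0r //.
  by move=> /allP/(_ h (mem_index_enum _))/eqP->.
by rewrite -mulrDr subrK mulr1.
Qed.

Let code := (option G * {ffun T -> H})%type.

Let wt (a : code) : R := mix a.1 * \prod_t comp a.1 t (a.2 t).

Let agree (a : code) := [forall t, forall t', pi (a.2 t) == pi (a.2 t')].

Let sum_code (f : code -> R) : \sum_a f a = \sum_c \sum_g f (c, g).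
Proof. by rewrite pair_bigA; apply: eq_bigr => -[]. Qed.

Let sum_wt : \sum_a wt a = 1.
Proof.
rewrite sum_code -sum_mix; apply: eq_bigr => c _; rewrite /wt /= -mulr_sumr.
rewrite -(bigA_distr_bigA (fun t h => comp c t h)) big1 ?mulr1 // => t _.
Qed.

Let marg_wt t h : \sum_(a : code | a.2 t == h) wt a = kap t h.
Proof.
rewrite -mix_comp big_mkcond sum_code; apply: eq_bigr => c _; rewrite /wt /=.
rewrite -big_mkcond -mulr_sumr /=; congr (_ * _).
transitivity (\sum_(g : {ffun T -> H}) \prod_s
    (comp c s (g s) * ((s == t) ==> (g s == h))%:R)).
  rewrite big_mkcond; apply: eq_bigr => g _; rewrite big_split /=.
  case: ifPn => [gt|gt].
    by rewrite [X in _ * X]big1 ?mulr1 // => s _; case: eqVneq => // ->; rewrite gt.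
  by rewrite [X in _ * X](bigD1 t) //= eqxx (negPf gt) mul0r mulr0.
rewrite -(bigA_distr_bigA (fun s x => comp c s x * ((s == t) ==> (x == h))%:R)).
rewrite (bigD1 t) //= [X in _ * X]big1 ?mulr1; last first.
  move=> s /negPf st; rewrite -[RHS](comp_sum1 c s).
  by apply: eq_bigr => x _; rewrite st mulr1.
rewrite (bigD1 h) //= !eqxx mulr1 big1 ?addr0 // => x /negPf xh.
by rewrite xh mulr0.
Qed.

Let wt_ge0 (t : T) a : 0 <= wt a.
Proof. by rewrite mulr_ge0 ?(mix_ge0 t) // prodr_ge0. Qed.

Let agree_wt (t : T) : \sum_o overlap o <= \sum_(a | agree a) wt a.
Proof.
rewrite [leRHS]big_mkcond sum_code mixE.
apply: (@le_trans _ _ (\sum_o \sum_g (if agree (Some o, g) then wt (Some o, g) else 0))); last first.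
  rewrite lerDr; apply: sumr_ge0 => g _; case: ifP => // _; exact: wt_ge0.
apply: ler_sum => o _.
rewrite [leRHS](eq_bigr (fun g : {ffun T -> H} => overlap o * \prod_t comp (Some o) t (g t))).
  rewrite -mulr_sumr -(bigA_distr_bigA (fun t h => comp (Some o) t h)).
  by rewrite big1 ?mulr1 // => s _; exact: comp_sum1.
move=> g _; rewrite -/(wt (Some o, g)); case: ifPn => // nag.
rewrite /wt /=; have [->|on0] := eqVneq (overlap o) 0; first by rewrite mul0r.
apply/esym/eqP; rewrite mulf_eq0 (negPf on0) /=; apply: contraNT nag.
rewrite prodf_seq_neq0 => /allP nz.
have E s : pi (g s) = o.
  have /= := nz s (mem_index_enum _); case: (q s o =P 0) => [/overlapq0 o0|_].
    by rewrite o0 eqxx in on0.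
  by case: (pi (g s) =P o) => //; rewrite eqxx.
by apply/forallP => s; apply/forallP => s'; rewrite !E.
Qed.

(** With probability [overlap o] all the laws are conditioned on the value [o] of
    [pi]; otherwise each one is drawn from what remains of it.  The code of the
    random map records the agreed value, if any, and the whole map, drawn
    independently over [T]. *)
Lemma coupling (t0 : T) :
  exists (n : nat) (nu : nat -> R) (F : nat -> T -> H) (agreed : pred nat),
  [/\ forall a, 0 <= nu a, \sum_(a < n) nu a = 1,
      forall t h, \sum_(a < n | F a t == h) nu a = kap t h,
      forall a t t', agreed a -> pi (F a t) = pi (F a t') &
      \sum_o overlap o <= \sum_(a < n | agreed a) nu a].
Proof.
have [h0 _] : exists h : H, true.
  have := kap1 t0; case: (pickP (fun _ : H => true)) => [h _|H0]; first by exists h.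
  by rewrite big_pred0 // => /esym/eqP; rewrite oner_eq0.
pose dec (a : nat) : code := nth (None, [ffun=> h0]) (enum {: code}) a.
have E (f : code -> R) (P : pred code) :
    \sum_(a < #|{: code}| | P (dec a)) f (dec a) = \sum_(a | P a) f a.
  rewrite [RHS](reindex (fun i : 'I_#|{: code}| => enum_val i)) /=; last first.
    exact/onW_bij/enum_val_bij.
  by apply: eq_big => i; rewrite /dec (enum_val_nth (None, [ffun=> h0])).
exists #|{: code}|, (wt \o dec), (fun a t => (dec a).2 t), (agree \o dec).
split=> [a|||a t t' /forallP/(_ t)/forallP/(_ t')/eqP//|].
- exact: wt_ge0.
- by rewrite (E wt xpredT).
- by move=> t h; rewrite (E wt (fun a : code => a.2 t == h)).
- by rewrite (E wt agree) agree_wt.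
Qed.

End Coupling.

(** * Balls and block dynamics on the lattice *)

Section Ball.
Variable d : nat.
Implicit Types (u v w : lattice d) (m n : nat).

Definition inball n v : bool := [forall i, (`|v ord0 i| <= n)%N].

Lemma inballP n v : reflect (forall i, (`|v ord0 i| <= n)%N) (inball n v).
Proof. exact: forallP. Qed.

Lemma inball0 n : inball n 0.
Proof. by apply/inballP => i; rewrite mxE. Qed.

Lemma inballN n v : inball n (- v) = inball n v.
Proof. by apply: eq_forallb => i; rewrite mxE abszN. Qed.

Lemma inball_le m n v : (m <= n)%N -> inball m v -> inball n v.
Proof. by move=> mn /inballP h; apply/inballP => i; exact: leq_trans (h i) mn. Qed.

Lemma absz_leD (a b : int) m n :
  (`|a| <= m)%N -> (`|b| <= n)%N -> (`|(a + b)%R| <= m + n)%N.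
Proof. by lia. Qed.

Lemma inballD m n u v : inball m u -> inball n v -> inball (m + n) (u + v).
Proof.
move=> /inballP hu /inballP hv; apply/inballP => i; rewrite mxE.
exact: absz_leD.
Qed.

Lemma inballB m n u v : inball m u -> inball n v -> inball (m + n) (u - v).
Proof. by move=> hu hv; apply: inballD => //; rewrite inballN. Qed.

Lemma inball_l1 n v : (l1norm v <= n)%N -> inball n v.
Proof.
move=> h; apply/inballP => i; apply: leq_trans h.
by rewrite /l1norm (bigD1 i) //= leq_addr.
Qed.

Lemma l1_inball n v : inball n v -> (l1norm v <= d * n)%N.
Proof.
move=> /inballP h; rewrite /l1norm.
apply: (@leq_trans (\sum_(i < d) n)); first by apply: leq_sum => i _; exact: h.
by rewrite sum_nat_const card_ord.
Qed.

Definition ballseq n : seq (lattice d) :=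
  [seq \row_i ((g i : nat)%:Z - n%:Z) | g : {ffun 'I_d -> 'I_(n + n).+1}].

Lemma mem_ballseq n v : (v \in ballseq n) = inball n v.
Proof.
have I1 (a : nat) : (a < (n + n).+1)%N -> (`|(a%:Z - n%:Z)%R| <= n)%N by lia.
have I2 (a : int) : (`|a| <= n)%N -> (`|(a + n%:Z)%R| < (n + n).+1)%N by lia.
have I3 (a : int) : (`|a| <= n)%N -> a = `|(a + n%:Z)%R|%:Z - n%:Z by lia.
apply/idP/inballP => [/mapP[g _ ->] i|h]; first by rewrite mxE; exact: I1.
apply/mapP; exists [ffun i => Ordinal (I2 _ (h i))]; first by rewrite mem_enum.
by apply/rowP => i; rewrite mxE ffunE; exact: I3.
Qed.

Lemma ballseq_uniq n : uniq (ballseq n).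
Proof.
rewrite map_inj_uniq ?enum_uniq // => g h /rowP e; apply/ffunP => i; apply/val_inj.
by have := e i; rewrite !mxE => /addIr [].
Qed.

Lemma size_ballseq n : size (ballseq n) = ((n + n).+1 ^ d)%N.
Proof. by rewrite size_map -cardE card_ffun !card_ord. Qed.

End Ball.

Lemma half_doubleS s : s.*2.+1./2 = s.
Proof. exact: uphalf_double. Qed.

Section Dynamics.
Variables (d : nat) (S : Type).
Local Notation cfg := (lattice d -> S).
Local Notation idx := (lattice d * nat)%type.
Implicit Types (u v w : lattice d) (x : cfg) (z : idx -> nat).

Variables (n m : nat -> nat) (B : nat -> nat -> cfg -> cfg) (succ : nat -> pred nat).

Definition shift u z : idx -> nat := fun i => z (i.1 + u, i.2).

(** At each site, slot [2 s] tells whether the site is a centre at time [- s], and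
    slot [2 s + 1] is the code of the resampling map that it would use. *)
Definition mark z s v : bool := z (v, s.*2) != 0%N.
Definition code z s v : nat := z (v, s.*2.+1).

(** With this spacing, the box of one active centre meets neither the box nor the
    boundary of the box of another one. *)
Definition active z s v : bool :=
  mark z s v && all (fun u => (u == 0) || ~~ mark z s (v + u)) (ballseq d (n s).*2.+1).

(** At most one active centre has [w] in its box, so that taking the first one of
    the list makes no choice. *)
Definition step s x z : cfg := fun w =>
  if [seq e <- ballseq d (n s) | active z s (w + e)] is e :: _
  then B s (code z s (w + e)) (translate (w + e) x) (- e) else x w.

(** Step [t] is the earliest one: as always in coupling from the past, more time
    means that randomness is inserted before the existing one. *)
Fixpoint history t x z : cfg :=
  if t is s.+1 then history s (step s x z) z else x.

(** The step changes a site according to a centre at distance at most [n], whose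
    activity is decided by marks within [2 n + 1] of that centre; the boundary of
    its box is closer. *)
Fixpoint radius t : nat := if t is s.+1 then (radius s + (n s + n s + n s).+1)%N else 0%N.

(** A sufficient condition for the step to hide the past from the window of radius
    [radius s] around the origin.  Looking for a single centre in one fixed ball
    makes the probability of the event a product. *)
Definition coal s z : bool :=
  has (fun v => [&& mark z s v, all (fun u => (u == v) || ~~ mark z s u)
       (ballseq d (m s + (n s).*2.+1)) & succ s (code z s v)]) (ballseq d (m s)).

Hypothesis Bloc : forall s a x x' w,
  (forall v, inball (n s).+1 v -> ~~ inball (n s) v -> x v = x' v) -> inball (n s) w ->
  B s a x w = B s a x' w.

Hypothesis Bsucc : forall s a x x' w, succ s a -> inball (radius s + m s) w ->
  B s a x w = B s a x' w.

Hypothesis mn : forall s, (radius s + m s <= n s)%N.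

Lemma translateD (T : Type) u v (x : lattice d -> T) : translate u (translate v x) = translate (u + v) x.
Proof. by apply/funext => w; rewrite /translate addrA. Qed.

Lemma shiftD u v z : shift u (shift v z) = shift (u + v) z.
Proof. by apply/funext => -[w k]; rewrite /shift /= addrA. Qed.

Lemma shift0 z : shift 0 z = z.
Proof. by apply/funext => -[w k]; rewrite /shift /= addr0. Qed.

Lemma mark_shift u z s v : mark (shift u z) s v = mark z s (v + u). Proof. by []. Qed.

Lemma code_shift u z s v : code (shift u z) s v = code z s (v + u). Proof. by []. Qed.

Lemma active_shift u z s v : active (shift u z) s v = active z s (v + u).
Proof.
rewrite /active mark_shift; congr (_ && _); apply: eq_all => e.
by rewrite mark_shift addrAC.
Qed.

Lemma step_shift u s x z w : step s (translate u x) (shift u z) w = step s x z (w + u).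
Proof.
rewrite /step (eq_filter (a2 := fun e => active z s (w + u + e))); last first.
  by move=> e; rewrite active_shift addrAC.
by case: [seq _ <- _ | _] => [|e l] //=; rewrite code_shift translateD addrAC.
Qed.

Lemma history_shift u t x z w :
  history t (translate u x) (shift u z) w = history t x z (w + u).
Proof.
elim: t x => //= t IH x; rewrite -IH; congr (history _ _ _ _).
by apply/funext => w'; rewrite step_shift.
Qed.

Lemma active_sep z s v v' : active z s v -> active z s v' -> v != v' ->
  ~~ inball (n s).*2.+1 (v' - v).
Proof.
move=> /andP[_ /allP hv] /andP[mv' _] vv'; apply/negP => h.
have := hv (v' - v); rewrite mem_ballseq h subr_eq0 eq_sym (negPf vv') /= => /(_ isT).
by rewrite addrC subrK mv'.
Qed.

Lemma step_in s x z v w : active z s v -> inball (n s) (w - v) ->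
  step s x z w = B s (code z s v) (translate v x) (w - v).
Proof.
move=> av wv; rewrite /step.
have : v - w \in [seq e <- ballseq d (n s) | active z s (w + e)].
  by rewrite mem_filter [w + _]addrC subrK av mem_ballseq -inballN opprB.
case E : [seq _ <- _ | _] => [|e l] // _.
have : e \in [seq e <- ballseq d (n s) | active z s (w + e)] by rewrite E mem_head.
rewrite mem_filter mem_ballseq => /andP[ae he].
have [->|/(active_sep av ae)/negP[]] := eqVneq v (w + e).
  by rewrite opprD addrA subrr add0r.
rewrite addrAC; apply: inball_le (inballD wv he).
by rewrite addnn.
Qed.

Lemma step_out s x z w :
  (forall v, inball (n s) (w - v) -> ~~ active z s v) -> step s x z w = x w.
Proof.
move=> h; rewrite /step; case E : [seq _ <- _ | _] => [|e l] //.
have : e \in [seq e <- ballseq d (n s) | active z s (w + e)] by rewrite E mem_head.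
rewrite mem_filter mem_ballseq => /andP[ae he].
have hw : inball (n s) (w - (w + e)) by rewrite opprD addrA subrr add0r inballN.
by have := h _ hw; rewrite ae.
Qed.

Lemma step_local s x x' z z' w :
  (forall v, inball (n s + n s + n s).+1 (v - w) -> x v = x' v) ->
  (forall v k, inball (n s + n s + n s).+1 (v - w) -> (k./2 == s) -> z (v, k) = z' (v, k)) ->
  step s x z w = step s x' z' w.
Proof.
move=> hx hz; have emark v : inball (n s + n s + n s).+1 (v - w) -> mark z s v = mark z' s v.
  by move=> hv; rewrite /mark hz // doubleK.
rewrite /step (eq_in_filter (a2 := fun e => active z' s (w + e))); last first.
  move=> e; rewrite mem_ballseq => he; rewrite /active; congr (_ && _).
    by apply: emark; rewrite addrC addKr; apply: inball_le he; lia.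
  apply: eq_in_all => u; rewrite mem_ballseq => hu; rewrite emark //.
  rewrite -(addrA w) [w + _]addrC addrK; apply: inball_le (inballD he hu); lia.
case E : [seq _ <- _ | _] => [|e l]; first by apply: hx; rewrite subrr inball0.
have : e \in [seq e <- ballseq d (n s) | active z' s (w + e)] by rewrite E mem_head.
rewrite mem_filter mem_ballseq => /andP[ae he].
have -> : code z s (w + e) = code z' s (w + e).
  rewrite /code hz //; last by rewrite half_doubleS.
  by rewrite addrC addKr; apply: inball_le he; lia.
apply: Bloc; last by rewrite inballN.
move=> v hv _; apply: hx; rewrite [w + e]addrC addrA addrK; apply: inball_le (inballD hv he); lia.
Qed.

Lemma radiusS s : radius s.+1 = (radius s + (n s + n s + n s).+1)%N. Proof. by []. Qed.

Lemma radius_mono s t : (s <= t)%N -> (radius s <= radius t)%N.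
Proof.
move=> /subnKC <-; elim: (t - s)%N => [|k IH]; first by rewrite addn0.
by rewrite addnS radiusS (leq_trans IH) // leq_addr.
Qed.

Lemma history_local t x x' z z' w :
  (forall v, inball (radius t) (v - w) -> x v = x' v) ->
  (forall v k, inball (radius t) (v - w) -> (k./2 < t)%N -> z (v, k) = z' (v, k)) ->
  history t x z w = history t x' z' w.
Proof.
elim: t x x' => [|t IH] x x' hx hz; first by apply: hx; rewrite subrr inball0.
have far v v' : inball (radius t) (v - w) -> inball (n t + n t + n t).+1 (v' - v) ->
    inball (radius t.+1) (v' - w).
  move=> h1 h2; have := inballD h1 h2; rewrite radiusS.
  by rewrite addrC addrA subrK.
apply: IH => [v hv|v k hv kt].
  apply: step_local => [v' hv'|v' k hv' /eqP kt]; first by apply: hx; exact: far hv'.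
  by apply: hz; [exact: far hv'|rewrite kt].
apply: hz; last by rewrite ltnW.
by apply: inball_le hv; exact: radius_mono.
Qed.

Lemma coal_local s z z' :
  (forall v k, inball (radius s.+1) v -> k./2 == s -> z (v, k) = z' (v, k)) ->
  coal s z = coal s z'.
Proof.
have mns := mn s.
move=> hz; have emark v : inball (radius s.+1) v -> mark z s v = mark z' s v.
  by move=> hv; rewrite /mark hz // doubleK.
apply: eq_in_has => v; rewrite mem_ballseq => hv.
have hv' : inball (radius s.+1) v by apply: inball_le hv; rewrite radiusS; lia.
congr [&& _, _ & _]; first exact: emark.
  apply: eq_in_all => u; rewrite mem_ballseq => hu; rewrite emark //.
  by apply: inball_le hu; rewrite radiusS; lia.
by rewrite /code hz // half_doubleS.
Qed.

(** The window lies in the inner part of the box of the lone centre, where a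
    successful map ignores the configuration. *)
Lemma coal_step s x x' z w : coal s z -> inball (radius s) w ->
  step s x z w = step s x' z w.
Proof.
move=> /hasP[v]; rewrite mem_ballseq => hv /and3P[mv /allP uv sv] hw.
have av : active z s v.
  rewrite /active mv /=; apply/allP => e; rewrite mem_ballseq => he.
  have [//|e0] /= := eqVneq e 0.
  have := uv (v + e); rewrite mem_ballseq inballD // => /(_ isT).
  by rewrite -subr_eq0 addrC addKr (negPf e0).
have wv : inball (radius s + m s) (w - v) by exact: inballB.
have wv' : inball (n s) (w - v) by apply: inball_le wv; exact: mn.
by rewrite !(step_in _ av) //; exact: Bsucc.
Qed.

(** Only the steps after the coalescing one matter, and by [coal_step] their input
    is determined on the window that the origin depends on. *)
Lemma history_coal s t x x' z : coal s z -> (s < t)%N ->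
  history t x z 0 = history s.+1 x' z 0.
Proof.
move=> cs /subnKC <-; elim: (t - s.+1)%N x => [|k IH] x.
  rewrite addn0 /=; apply: history_local => // v; rewrite subr0 => hv.
  exact: coal_step.
by rewrite addnS; exact: IH.
Qed.

End Dynamics.

(** * Invariance of the field under the dynamics *)

Section Invariance.
Variables (R : realType) (d : nat) (S : finType) (s0 : S).
Local Notation cfg := (lattice d -> S).
Local Notation idx := (lattice d * nat)%type.
Implicit Types (u v w : lattice d) (x : cfg) (z : idx -> nat) (W : {fset lattice d}).

Variables (n : nat -> nat) (B : nat -> nat -> cfg -> cfg).
Variables (Nc : nat -> nat) (nu : nat -> nat -> R) (dens : nat -> R).
Variable pr : {fset lattice d} -> cfg -> R.

Definition ext W (om : {ffun W -> S}) : cfg :=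
  fun v => if insub v is Some v' then om v' else s0.

Definition agree_on W x y := [forall v : W, x (val v) == y (val v)].

(** The probability that resampling the block in the configuration [x] writes the
    values of [y]. *)
Definition kernel s x y : R :=
  \sum_(a < Nc s | all (fun w => B s a x w == y w) (ballseq d (n s))) nu s a.

Definition off_block W s v : {fset lattice d} :=
  [fset u in W | ~~ inball (n s) (u - v)]%fset.

Hypothesis pr_marginal : forall W W0 y, {subset W0 <= W} ->
  pr W0 y = \sum_(om : {ffun W -> S} | agree_on W0 (ext om) y) pr W (ext om).
Hypothesis pr_fset0 : forall x, pr fset0 x = 1.
Hypothesis pr_block : forall s v W x,
  (forall u, inball (n s).+1 (u - v) -> u \in W) ->
  pr W x = pr (off_block W s v) x * kernel s (translate v x) (translate v x).

Hypothesis Bloc : forall s a x x' w,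
  (forall v, inball (n s).+1 v -> ~~ inball (n s) v -> x v = x' v) -> inball (n s) w ->
  B s a x w = B s a x' w.

(** The expectation under the field of a function of the values in [W].  All the
    functions that occur are local, so that finite sums suffice. *)
Definition EX W (h : cfg -> R) : R := \sum_(om : {ffun W -> S}) pr W (ext om) * h (ext om).

Definition local_on (T : Type) W (h : cfg -> T) :=
  forall x y, (forall v, v \in W -> x v = y v) -> h x = h y.

Lemma extE W (om : {ffun W -> S}) (v : W) : ext om (val v) = om v.
Proof. by rewrite /ext valK. Qed.

Lemma ext_restr W x v : v \in W -> ext (restr W x) v = x v.
Proof. by move=> vW; rewrite -[v]/(val (FSetSub vW)) extE ffunE. Qed.

Lemma eq_EX W h h' : (forall x, h x = h' x) -> EX W h = EX W h'.
Proof. by move=> e; apply: eq_bigr => om _; rewrite e. Qed.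

Lemma EX_lin W (J : Type) (r : seq J) (c : J -> R) (h : J -> cfg -> R) :
  EX W (fun x => \sum_(j <- r) c j * h j x) = \sum_(j <- r) c j * EX W (h j).
Proof.
rewrite /EX; under eq_bigr do rewrite mulr_sumr.
rewrite exchange_big; apply: eq_bigr => j _; rewrite mulr_sumr.
by apply: eq_bigr => om _; rewrite mulrCA.
Qed.

Lemma EX_const W c : EX W (fun=> c) = c.
Proof.
rewrite /EX -mulr_suml; rewrite -[RHS]mul1r; congr (_ * _).
rewrite -(pr_fset0 (fun=> s0)) (pr_marginal (W := W)) //.
by apply: eq_bigl => om; apply/esym/forallP => -[].
Qed.

Definition block s v a x : cfg := fun w =>
  if inball (n s) (w - v) then B s a (translate v x) (w - v) else x w.

Lemma block_local s v a W (T : Type) (h : cfg -> T) :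
  (forall u, inball (n s).+1 (u - v) -> u \in W) -> local_on W h ->
  local_on W (fun x => h (block s v a x)).
Proof.
move=> hW hh x y e; apply: hh => w wW; rewrite /block.
case: ifP => hw; last exact: e.
apply: Bloc => // u hu _; apply: e; apply: hW; by rewrite addrK.
Qed.

Lemma block_restrE s v a W (om om' : {ffun W -> S}) :
  (forall u, inball (n s).+1 (u - v) -> u \in W) ->
  (restr W (block s v a (ext om)) == om') =
  agree_on (off_block W s v) (ext om) (ext om') &&
  all (fun w => B s a (translate v (ext om')) w == translate v (ext om') w) (ballseq d (n s)).
Proof.
move=> hW.
have bdE : agree_on (off_block W s v) (ext om) (ext om') -> forall w, inball (n s) w ->
    B s a (translate v (ext om)) w = B s a (translate v (ext om')) w.
  move=> /forallP ag w hw; apply: Bloc => // u hu hu'; rewrite /translate.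
  have uo : u + v \in off_block W s v by rewrite !inE /= addrK hu' andbT hW // addrK.
  by have /eqP := ag (FSetSub uo).
apply/eqP/andP => [e|[ag /allP hb]].
  have E w : w \in W -> block s v a (ext om) w = ext om' w.
    by move=> wW; rewrite -e ext_restr.
  have ag : agree_on (off_block W s v) (ext om) (ext om').
    apply/forallP => -[w /= ]; rewrite !inE /= => /andP[wW hw].
    by rewrite -E // /block (negPf hw).
  split=> //; apply/allP => w; rewrite mem_ballseq => hw.
  rewrite -bdE // {2}/translate -E; last by rewrite hW // addrK; apply: inball_le hw.
  by rewrite /block addrK hw.
apply/ffunP => w; rewrite ffunE /block -extE; case: ifPn => hw.
  rewrite bdE //; have /eqP -> := hb (val w - v) (etrans (mem_ballseq _ _) hw).
  by rewrite /translate subrK.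
have wo : val w \in off_block W s v by rewrite !inE /= (valP w).
by have /forallP/(_ (FSetSub wo))/eqP := ag.
Qed.

(** The pattern [om'] can only arise from the patterns that agree with it off the
    block.  They see the same boundary, hence produce it with the same
    probability, [kernel om' om'], and their total weight is that of the pattern
    off the block; [pr_block] says that the product is the weight of [om']. *)
Lemma block_inv s v W h : (forall u, inball (n s).+1 (u - v) -> u \in W) ->
  local_on W h ->
  EX W (fun x => \sum_(a < Nc s) nu s a * h (block s v a x)) = EX W h.
Proof.
move=> hW hh; rewrite /EX.
transitivity (\sum_(om' : {ffun W -> S}) (\sum_(om : {ffun W -> S}) pr W (ext om) *
    \sum_(a < Nc s | restr W (block s v a (ext om)) == om') nu s a) * h (ext om')).
  under [RHS]eq_bigr do rewrite mulr_suml.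
  rewrite exchange_big; apply: eq_bigr => om _; rewrite /=.
  under [RHS]eq_bigr do rewrite -mulrA.
  rewrite -mulr_sumr; congr (_ * _).
  under [RHS]eq_bigr do rewrite mulr_suml big_mkcond.
  rewrite exchange_big; apply: eq_bigr => a _ /=.
  rewrite (bigD1 (restr W (block s v a (ext om)))) //= eqxx big1 ?addr0.
    by congr (_ * _); apply: hh => w wW; rewrite ext_restr.
  by move=> om' /negPf; rewrite eq_sym => ->.
apply: eq_bigr => om' _; congr (_ * _).
rewrite [RHS](pr_block _ hW) (pr_marginal (W := W)); last first.
  by move=> u; rewrite !inE => /andP[].
rewrite big_mkcond mulr_suml [RHS]big_mkcond; apply: eq_bigr => om _.
under eq_bigl do rewrite block_restrE //.
by case: ifP => ag /=; rewrite ?mul0r // big_pred0_eq mulr0.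
Qed.

(** Blocks resampled one after another.  For separated centres this agrees with
    resampling them in parallel, and is more convenient for invariance. *)
Definition sweep s (act : pred (lattice d)) (K : seq (lattice d)) z x : cfg :=
  foldr (fun v x => if act v then block s v (code z s v) x else x) x K.

Definition codes s (K : seq (lattice d)) : seq idx := [seq (v, s.*2.+1) | v <- K].

Definition sizes (i : idx) : nat := if odd i.2 then Nc i.2./2 else 2%N.
Definition laws (i : idx) (a : nat) : R :=
  if odd i.2 then nu i.2./2 a else if a == 0%N then 1 - dens i.2./2 else dens i.2./2.

Local Notation avg := (avg sizes laws).

Hypothesis nu1 : forall s, \sum_(a < Nc s) nu s a = 1.

Lemma sweep_inv s act K W h z : uniq K ->
  (forall v, v \in K -> forall u, inball (n s).+1 (u - v) -> u \in W) ->
  local_on W h ->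
  avg (codes s K) (fun z => EX W (fun x => h (sweep s act K z x))) z = EX W h.
Proof.
elim: K h z => //= v K IH h z /andP[vK uK] hW hh.
have hW' u : u \in K -> forall u0, inball (n s).+1 (u0 - u) -> u0 \in W.
  by move=> uK'; apply: hW; rewrite inE uK' orbT.
have hWv := hW v (mem_head _ _).
rewrite /sizes /= odd_double /= uphalf_double.
pose ha a x := if act v then h (block s v a x) else h x.
transitivity (\sum_(a < Nc s) nu s a * EX W (ha a)).
  apply: eq_bigr => a _; rewrite /laws /= odd_double /= uphalf_double; congr (_ * _).
  rewrite -(IH (ha a) (upd z (v, s.*2.+1) a)) //; last first.
    by rewrite /ha; case: (act v) => //; exact: block_local.
  apply: eq_avg => z' e; apply: eq_EX => x; rewrite /ha.
  have -> : code z' s v = a; last by case: (act v).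
  rewrite /code e ?upd_same //; apply: contra vK => /mapP[u uK' [->]] //.
rewrite -EX_lin /ha; case: (act v); first exact: block_inv.
by apply: eq_EX => x; rewrite -mulr_suml nu1 mul1r.
Qed.

(** No block reads a site that another block writes, so that the order of the
    blocks is irrelevant. *)
Lemma sweepE s K z x w : uniq K ->
  (forall v, inball (n s) (w - v) -> v \in K) ->
  sweep s (active n z s) K z x w = step n B s x z w.
Proof.
move=> uK hK.
suff [h1 h2] : (forall w v, v \in K -> active n z s v -> inball (n s) (w - v) ->
    sweep s (active n z s) K z x w = B s (code z s v) (translate v x) (w - v)) /\
   (forall w, (forall v, v \in K -> active n z s v -> ~~ inball (n s) (w - v)) ->
     sweep s (active n z s) K z x w = x w).
  have [[v [vK av wv]]|nex] := pselect (exists v, [/\ v \in K, active n z s v & inball (n s) (w - v)]).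
    by rewrite (h1 _ v) // (step_in _ _ av).
  have hno v : v \in K -> active n z s v -> ~~ inball (n s) (w - v).
    by move=> vK av; apply/negP => wv; apply: nex; exists v.
  rewrite h2 // step_out // => v wv; apply/negP => av.
  by have := hno v (hK v wv) av; rewrite wv.
elim: K uK {hK w} => [|v K IH] //= /andP[vK uK].
have {IH uK} [IH1 IH2] := IH uK; split.
  move=> w v'; rewrite inE => /orP[/eqP->{v'}|v'K] av' wv.
    rewrite av' /block wv; apply: Bloc => // u hu hu'; rewrite /translate IH2 // => v' v'K av.
    have vv' : v != v' by apply: contraNneq vK => ->.
    apply: contraNN (active_sep av' av vv') => h.
    have -> : v' - v = u - (u + v - v') by rewrite opprB addrCA opprD addNKr.
    by apply: inball_le (inballB hu h); rewrite addSn addnn.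
  case: ifP => [av|_]; last exact: IH1.
  rewrite /block; case: ifP => [h|_]; last exact: IH1.
  have vv' : v != v' by apply: contraNneq vK => ->.
  have /negP[] := active_sep av av' vv'.
  have -> : v' - v = (w - v) - (w - v') by rewrite opprB [RHS]addrC subrKA.
  by apply: inball_le (inballB h wv); rewrite addnn.
move=> w hno; have hw := hno v (mem_head _ _).
have hK v' : v' \in K -> active n z s v' -> ~~ inball (n s) (w - v').
  by move=> v'K; apply: hno; rewrite inE v'K orbT.
case: ifP => [av|_]; last exact: IH2.
by rewrite /block (negPf (hw av)); exact: IH2.
Qed.

Lemma codes_uniq s K : uniq K -> uniq (codes s K).
Proof. by move=> uK; rewrite map_inj_uniq // => u v []. Qed.

Lemma mem_codes s K v k : ((v, k) \in codes s K) = (k == s.*2.+1) && (v \in K).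
Proof.
apply/mapP/andP => [[u uK [-> ->]]|[/eqP-> vK]]; first by rewrite eqxx.
by exists v.
Qed.

(** Conditionally on the marks, a step resamples finitely many separated blocks as
    far as the window is concerned; averaging over the codes alone is enough. *)
Lemma step_inv s (r : nat) W h z :
  (forall u, inball (r + (n s + n s).+1) u -> u \in W) ->
  (forall x y, (forall v, inball r v -> x v = y v) -> h x = h y) ->
  avg (codes s (ballseq d (r + n s))) (fun z => EX W (fun x => h (step n B s x z))) z = EX W h.
Proof.
move=> hW hh; set K := ballseq d _.
rewrite -(@sweep_inv s (active n z s) K W h z) ?ballseq_uniq //; last first.
- by move=> x y e; apply: hh => v hv; apply: e; apply: hW; apply: inball_le hv; exact: leq_addr.
- move=> v; rewrite mem_ballseq => hv u hu; apply: hW.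
  by rewrite -(subrK v u); apply: inball_le (inballD hu hv); lia.
apply: eq_avg => z' e; apply: eq_EX => x; apply: hh => w hw.
have mz v : mark z' s v = mark z s v.
  by rewrite /mark e // mem_codes; apply/negP => /andP[/eqP/(congr1 odd)]; rewrite /= odd_double.
have az : active n z' s = active n z s.
  apply/funext => v; rewrite /active mz; congr (_ && _).
  by apply: eq_all => u; rewrite mz.
rewrite -az -(sweepE z' x (K := K)) ?ballseq_uniq // => v hv.
rewrite mem_ballseq -(subKr w v); apply: inballB => //.
Qed.

Local Notation radius := (radius n).

Fixpoint all_codes r t : seq idx :=
  if t is s.+1 then all_codes r s ++ codes s (ballseq d (r + radius s + n s)) else [::].

Lemma mem_all_codes r t v k : (v, k) \in all_codes r t -> (k./2 < t)%N /\ odd k.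
Proof.
elim: t => //= t IH; rewrite mem_cat mem_codes => /orP[/IH[h ->]|/andP[/eqP-> _]].
  by split=> //; exact: ltnW.
by rewrite half_doubleS /= odd_double.
Qed.

Lemma all_codes_uniq r t : uniq (all_codes r t).
Proof.
elim: t => //= t IH; rewrite cat_uniq IH codes_uniq ?ballseq_uniq // andbT /=.
apply/hasPn => -[v k]; rewrite mem_codes => /andP[/eqP-> _].
by apply/negP => /mem_all_codes []; rewrite half_doubleS ltnn.
Qed.

(** The earliest step acts first on the field and leaves its law invariant, whatever
    the later randomness does with the outcome. *)
Lemma history_inv t r W h z :
  (forall u, inball (r + radius t) u -> u \in W) ->
  (forall x y, (forall v, inball r v -> x v = y v) -> h x = h y) ->
  avg (all_codes r t) (fun z => EX W (fun x => h (history n B t x z))) z = EX W h.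
Proof.
move=> + hh; elim: t z => //= t IH z hW.
rewrite avg_cat -(IH z); last by move=> u hu; apply: hW; apply: inball_le hu; lia.
apply: eq_avg => z1 _.
have hl x y z' : (forall v, inball (r + radius t) v -> x v = y v) ->
    (forall i, i \notin codes t (ballseq d (r + radius t + n t)) -> z' i = z1 i) ->
    h (history n B t x z') = h (history n B t y z1).
  move=> exy ez; apply: hh => w hw; apply: history_local => // [v hv|v k _ kt].
    by apply: exy; rewrite -(subrK w v) addrC; exact: inballD.
  apply: ez; rewrite mem_codes; apply/negP => /andP[/eqP k_eq _].
  by move: kt; rewrite k_eq half_doubleS ltnn.
rewrite -(@step_inv t (r + radius t) W (fun x => h (history n B t x z1)) z1).
- by apply: eq_avg => z' e; apply: eq_EX => x; exact: hl.
- by move=> u hu; apply: hW; apply: inball_le hu; lia.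
- by move=> x y e; exact: hl.
Qed.

Lemma history_inv_sup t r W h z (K : seq idx) :
  is_law sizes laws -> uniq K ->
  (forall v k, inball (r + radius t) v -> (k < t.*2)%N -> (v, k) \in K) ->
  (forall u, inball (r + radius t) u -> u \in W) ->
  (forall x y, (forall v, inball r v -> x v = y v) -> h x = h y) ->
  avg K (fun z => EX W (fun x => h (history n B t x z))) z = EX W h.
Proof.
move=> lawP uK hK hW hh.
have sK : {subset all_codes r t <= K}.
  suff H s : (s <= t)%N -> {subset all_codes r s <= K} by exact: H.
  elim: s => //= s IH st [v k]; rewrite mem_cat => /orP[/IH->//|]; first exact: ltnW.
  rewrite mem_codes mem_ballseq => /andP[/eqP-> hv]; apply: hK; last by lia.
  apply: inball_le hv; have := radius_mono n st; rewrite /=; lia.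
have /avg_perm-> := perm_filter_cat (all_codes_uniq r t) uK sK.
rewrite avg_cat -[RHS](avg_const lawP [seq i <- K | i \notin all_codes r t] _ z).
by apply: eq_avg => z' _; rewrite history_inv.
Qed.

End Invariance.

(** * Probability of coalescence *)

Lemma bernoulli_ineq (R : realType) (p : R) k : 0 <= p <= 1 -> 1 - k%:R * p <= (1 - p) ^+ k.
Proof.
move=> /andP[p0 p1]; elim: k => [|k IH]; first by rewrite mul0r subr0.
have q0 : 0 <= 1 - p by rewrite subr_ge0.
rewrite exprS; apply: (@le_trans _ _ ((1 - p) * (1 - k%:R * p))); last by rewrite ler_wpM2l.
rewrite -natr1; have : 0 <= k%:R * (p * p) by rewrite !mulr_ge0.
by move: (k%:R) => y; nra.
Qed.

Lemma prod_bool (R : realType) (T : Type) (l : seq T) (b : pred T) :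
  \prod_(j <- l) (b j)%:R = (all b l)%:R :> R.
Proof.
by elim: l => [|u l IH]; rewrite ?big_nil // big_cons IH -natrM mulnb.
Qed.

Section Coalescence.
Variables (R : realType) (d : nat).
Local Notation idx := (lattice d * nat)%type.
Implicit Types (u v w : lattice d) (z : idx -> nat).
Variables (n m : nat -> nat) (succ : nat -> pred nat).
Variables (Nc : nat -> nat) (nu : nat -> nat -> R) (dens : nat -> R).

Local Notation sizes := (@sizes d Nc).
Local Notation laws := (@laws R d nu dens).
Local Notation avg := (avg sizes laws).
Local Notation coal := (coal n m succ).
Local Notation radius := (radius n).

Hypothesis lawP : is_law sizes laws.
Hypothesis mn : forall s, (radius s + m s <= n s)%N.

Let M s := (m s + (n s).*2.+1)%N.

Definition succ_prob s := \sum_(a < Nc s | succ s a) nu s a.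

(** The event that [v] is the centre sought by [coal]. *)
Definition lone s v z : bool :=
  [&& mark z s v, all (fun u => (u == v) || ~~ mark z s u) (ballseq d (M s)) &
    succ s (code z s v)].

Definition lone_slots s v : seq idx := rcons [seq (u, s.*2) | u <- ballseq d (M s)] (v, s.*2.+1).

Lemma mem_lone_slots s v u k : (u, k) \in lone_slots s v ->
  (k./2 == s) && (inball (M s) u || (u == v)).
Proof.
rewrite mem_rcons inE => /orP[/eqP[-> ->]|/mapP[w]].
  by rewrite half_doubleS !eqxx orbT.
by rewrite mem_ballseq => hw [-> ->]; rewrite doubleK eqxx hw.
Qed.

Lemma lone_slots_uniq s v : uniq (lone_slots s v).
Proof.
rewrite rcons_uniq map_inj_uniq ?ballseq_uniq ?andbT; last by move=> u w [].
by apply/mapP => -[u _ [_ /(congr1 odd)]]; rewrite /= odd_double.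
Qed.

Lemma lone_prod s v z : inball (m s) v -> (lone s v z)%:R =
  \prod_(i <- lone_slots s v) (if odd i.2 then succ s (z i) else
     if i.1 == v then z i != 0%N else z i == 0%N)%:R :> R.
Proof.
move=> hv; have vM : v \in ballseq d (M s) by rewrite mem_ballseq; apply: inball_le hv; exact: leq_addr.
rewrite big_rcons /= odd_double /= big_map.
rewrite prod_bool /lone andbA -natrM mulnb; congr ((_ && _)%:R).
apply/andP/allP => [[mv /allP h] u uM|h].
  by rewrite odd_double; have := h u uM; case: eqP => [->|_] //=; rewrite /mark negbK.
split; first by have := h v vM; rewrite odd_double eqxx.
by apply/allP => u /h; rewrite odd_double; case: eqP => //= _; rewrite /mark negbK.
Qed.

Lemma lone_avg s v z : inball (m s) v ->
  avg (lone_slots s v) (fun z => (lone s v z)%:R) z =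
  dens s * (1 - dens s) ^+ (size (ballseq d (M s))).-1 * succ_prob s.
Proof.
move=> hv; have vM : v \in ballseq d (M s) by rewrite mem_ballseq; apply: inball_le hv; exact: leq_addr.
under [LHS]eq_avg => z' _ do rewrite lone_prod //.
rewrite (avg_prod _ _ (fun i a => (if odd i.2 then succ s a else
     if i.1 == v then a != 0%N else a == 0%N)%:R)) ?lone_slots_uniq //.
rewrite big_rcons /= /sizes /laws /= odd_double /= uphalf_double big_map.
congr (_ * _); last first.
  rewrite /succ_prob [RHS]big_mkcond; apply: eq_bigr => a _.
  by case: (succ s a); rewrite ?mulr1 ?mulr0.
rewrite (bigD1_seq v) ?ballseq_uniq //= odd_double eqxx doubleK.
rewrite !big_ord_recl big_ord0 /= mulr0 mulr1 add0r addr0; congr (_ * _).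
transitivity (\prod_(u <- ballseq d (M s) | u != v) (1 - dens s)).
  apply: eq_bigr => u /negPf uv; rewrite uv.
  by rewrite !big_ord_recl big_ord0 /= mulr0 mulr1 !addr0.
rewrite big_const_seq iter_mulr_1; congr (_ ^+ _).
by rewrite -(count_predC (pred1 v) (ballseq d (M s))) /= count_uniq_mem ?ballseq_uniq // vM.
Qed.

(** Two lone centres would each forbid the mark of the other. *)
Lemma lone_coal s z : \sum_(v <- ballseq d (m s)) (lone s v z)%:R <= (coal s z)%:R :> R.
Proof.
have [|nc] := boolP (coal s z); last first.
  rewrite big_seq big1 // => v vm; move: nc; rewrite -all_predC => /allP/(_ v vm) /=.
  by rewrite /lone /M => /negPf->.
move=> /hasP[v vm hv]; rewrite (bigD1_seq v) ?ballseq_uniq //= big_seq_cond big1 ?addr0.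
  by rewrite lern1 leq_b1.
move=> u /andP[um uv]; move: hv => /and3P[mv _ _].
suff /negPf-> : ~~ lone s u z by [].
have vM : v \in ballseq d (M s).
  by move: vm; rewrite !mem_ballseq => vm; apply: inball_le vm; exact: leq_addr.
apply/negP => /and3P[_ /allP/(_ v vM)].
by rewrite eq_sym (negPf uv) mv.
Qed.

Definition slots s : seq idx :=
  [seq (v, s.*2) | v <- ballseq d (radius s.+1)] ++ [seq (v, s.*2.+1) | v <- ballseq d (radius s.+1)].

Lemma mem_slots s v k : ((v, k) \in slots s) = (k./2 == s) && inball (radius s.+1) v.
Proof.
rewrite mem_cat; apply/orP/andP => [[]/mapP[u]|[/eqP<- hv]].
- by rewrite mem_ballseq => hu [-> ->]; rewrite doubleK.
- by rewrite mem_ballseq => hu [-> ->]; rewrite half_doubleS.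
case: (boolP (odd k)) => ok; [right|left]; apply/mapP; exists v; rewrite ?mem_ballseq //.
  by congr (_, _); rewrite -[LHS]odd_double_half ok.
by congr (_, _); rewrite -[LHS]odd_double_half (negPf ok).
Qed.

Lemma slots_uniq s : uniq (slots s).
Proof.
rewrite cat_uniq; apply/and3P; split.
- by rewrite map_inj_uniq ?ballseq_uniq // => u w [].
- apply/hasPn => i /mapP[v _ ->]; apply/mapP => -[u _ [_ /(congr1 odd)]].
  by rewrite /= odd_double.
- by rewrite map_inj_uniq ?ballseq_uniq // => u w [].
Qed.

(** The lone events are disjoint and each one is a product over the slots.  With
    this density, no other site of the ball is marked with probability at least
    one half, by the Bernoulli inequality. *)
Lemma coal_avg_ge s z : dens s = (2 * (size (ballseq d (M s)))%:R)^-1 ->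
  (size (ballseq d (m s)))%:R / (4 * (size (ballseq d (M s)))%:R) * succ_prob s <=
  avg (slots s) (fun z => (coal s z)%:R) z.
Proof.
move=> pE; have := mn s => mns.
apply: le_trans (avg_mono lawP (slots s) z (lone_coal s)).
rewrite avg_sum.
rewrite (eq_big_seq
  (fun=> dens s * (1 - dens s) ^+ (size (ballseq d (M s))).-1 * succ_prob s)); last first.
  move=> v; rewrite mem_ballseq => hv; rewrite -(lone_avg z hv).
  apply: avg_sup; rewrite ?lone_slots_uniq ?slots_uniq //.
    move=> [u k] /mem_lone_slots /andP[ks hu]; rewrite mem_slots ks /=.
    case/orP: hu => [hu|/eqP->]; last by apply: inball_le hv; rewrite /=; lia.
    by apply: inball_le hu; rewrite /M /=; lia.
  by move=> z1 z2 e; rewrite !lone_prod //; apply: eq_big_seq => i /e ->.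
rewrite big_const_seq count_predT iter_addr_0 -[leRHS]mulr_natl.
set k := size (ballseq d (M s)).
have k0 : (0 < k)%N by rewrite /k size_ballseq expn_gt0.
have sp0 : 0 <= succ_prob s.
  apply: sumr_ge0 => a _; have [h _] := lawP (0, s.*2.+1).
  by have := h a; rewrite /laws /= odd_double /= uphalf_double.
rewrite mulrA ler_wpM2r //.
have kr : 0 < k%:R :> R by rewrite ltr0n.
have k1 : 1 <= k%:R :> R by rewrite ler1n.
have p01 : 0 <= dens s <= 1.
  rewrite pE invr_ge0 mulr_ge0 //= ?ler0n // invf_le1; last by rewrite mulr_gt0.
  by rewrite -[leLHS]mul1r ler_pM // ler1n.
have h : 2^-1 <= (1 - dens s) ^+ k.-1.
  apply: le_trans (bernoulli_ineq k.-1 p01).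
  apply: (@le_trans _ _ (1 - k%:R * dens s)).
    by rewrite pE invfM mulrCA divff ?gt_eqF // mulr1; lra.
  by rewrite lerD2l lerN2 ler_wpM2r //; [case/andP: p01|rewrite ler_nat leq_pred].
apply: (@le_trans _ _ ((size (ballseq d (m s)))%:R * (dens s * 2^-1))).
  rewrite ler_wpM2l ?ler0n // pE le_eqVlt; apply/orP; left; apply/eqP.
  by rewrite -/k; field; rewrite gt_eqF.
by rewrite ler_wpM2l ?ler0n // ler_wpM2l //; case/andP: p01.
Qed.

Fixpoint all_slots t : seq idx :=
  if t is s.+1 then all_slots s ++ slots s else [::].

Lemma mem_all_slots t v k : (v, k) \in all_slots t -> (k./2 < t)%N /\ inball (radius t) v.
Proof.
elim: t => //= t IH; rewrite mem_cat mem_slots => /orP[/IH[h1 h2]|/andP[/eqP-> h2]].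
  by split; [exact: ltnW|apply: inball_le h2; exact: leq_addr].
by split.
Qed.

Lemma all_slots_uniq t : uniq (all_slots t).
Proof.
elim: t => //= t IH; rewrite cat_uniq IH slots_uniq andbT /=.
apply/hasPn => -[v k]; rewrite mem_slots => /andP[/eqP kt _].
by apply/negP => /mem_all_slots []; rewrite kt ltnn.
Qed.

Definition uncoal t z : bool := all (fun s => ~~ coal s z) (iota 0 t).

Lemma uncoalS t z : uncoal t.+1 z = uncoal t z && ~~ coal t z.
Proof. by rewrite /uncoal -addn1 iotaD all_cat /= andbT add0n. Qed.

Lemma uncoal_local t z z' : (forall i, i \in all_slots t -> z i = z' i) ->
  uncoal t z = uncoal t z'.
Proof.
elim: t => // t IH e; rewrite !uncoalS IH; last by move=> i it; apply: e; rewrite /= mem_cat it.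
congr (_ && ~~ _); apply: coal_local => // v k hv kt; apply: e.
by rewrite /= mem_cat mem_slots kt hv orbT.
Qed.

(** The attempts at different times use disjoint sets of slots. *)
Lemma uncoal_avg_le t z (c : R) :
  (forall s z, c <= avg (slots s) (fun z => (coal s z)%:R) z) ->
  avg (all_slots t) (fun z => (uncoal t z)%:R) z <= (1 - c) ^+ t.
Proof.
move=> hc; have c1 : 0 <= 1 - c.
  rewrite subr_ge0 (le_trans (hc 0 z)) // -[leRHS](avg_const lawP (slots 0) _ z).
  by apply: avg_mono => // z'; rewrite lern1 leq_b1.
elim: t z => [|t IH] z; first by rewrite expr0.
rewrite /= avg_cat exprSr.
apply: (@le_trans _ _ (avg (all_slots t) (fun z => (1 - c) * (uncoal t z)%:R) z)); last first.
  by rewrite avg_scale mulrC ler_wpM2r.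
apply: avg_mono => // z1.
have -> : avg (slots t) (fun z => (uncoal t.+1 z)%:R) z1 =
    avg (slots t) (fun z => (uncoal t z1)%:R * (1 - (coal t z)%:R)) z1.
  apply: eq_avg => z' e; rewrite uncoalS.
  rewrite (uncoal_local (z' := z1)); last first.
    move=> [v k] /mem_all_slots[kt _]; apply: e.
    by rewrite mem_slots; apply/negP => /andP[/eqP k_eq _]; rewrite k_eq ltnn in kt.
  by case: (uncoal t z1); case: (coal t z'); rewrite /= ?mul0r ?subrr ?subr0 ?mulr0 ?mulr1.
rewrite avg_scale mulrC ler_wpM2r // avg_sub avg_const // lerD2l lerN2.
exact: hc.
Qed.

End Coalescence.

(** * Product sigma-algebras and independent noise *)

(** Dynkin's pi-lambda argument.  For [E] the full event and [c = 1] it identifies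
    two laws; for [X1 = X2] and [P1 = P2] it says that the variable is independent
    of [E], with [c] the probability of [E]. *)
Lemma law_ext (R : realType) (U : Type) (G : set (set U))
    (d1 d2 : measure_display) (T1 : measurableType d1) (T2 : measurableType d2)
    (P1 : probability T1 R) (P2 : probability T2 R) (X1 : T1 -> U) (X2 : T2 -> U)
    (E : set T1) (c : R) :
  setI_closed G -> measurable E -> P1 E = c%:E ->
  (forall A, G A -> [/\ measurable (X1 @^-1` A), measurable (X2 @^-1` A) &
     P1 (X1 @^-1` A `&` E) = (c%:E * P2 (X2 @^-1` A))%E]) ->
  forall A, <<s G >> A -> [/\ measurable (X1 @^-1` A), measurable (X2 @^-1` A) &
     P1 (X1 @^-1` A `&` E) = (c%:E * P2 (X2 @^-1` A))%E].
Proof.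
move=> GI mE PE hG.
pose H := [set A : set U | [/\ measurable (X1 @^-1` A), measurable (X2 @^-1` A) &
     P1 (X1 @^-1` A `&` E) = (c%:E * P2 (X2 @^-1` A))%E]].
suff : <<s G >> `<=` H by move=> h A /h.
rewrite -setI_closed_g_dynkin_g_sigma_algebra //; apply: smallest_sub => //.
split.
- rewrite /H /= !preimage_setT; split=> //.
  by rewrite setTI PE probability_setT mule1.
- move=> A [m1 m2 e].
  have m1' : measurable (X1 @^-1` (~` A)) := measurableC m1.
  have m2' : measurable (X2 @^-1` (~` A)) := measurableC m2.
  split=> //.
  change (P1 (~` (X1 @^-1` A) `&` E) = (c%:E * P2 (~` (X2 @^-1` A)))%E).
  rewrite probability_setC // muleBr //.
  rewrite mule1 -e -PE setIC -setDE measureD //; first by rewrite setIC.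
  by rewrite ltey_eq fin_num_measure.
- move=> F tF hF; rewrite /H /= !preimage_bigcup; split.
  + by apply: bigcup_measurable => k _; case: (hF k).
  + by apply: bigcup_measurable => k _; case: (hF k).
  have c0 : 0 <= c by rewrite -lee_fin -PE measure_ge0.
  rewrite setI_bigcupl measure_bigcup //; last 2 first.
  + by move=> k _; apply: measurableI => //; case: (hF k).
  + apply: sub_trivIset (subsetT _) _; apply/trivIsetP => i j _ _ ij.
    rewrite setIACA -preimage_setI; move/trivIsetP: tF => /(_ i j Logic.I Logic.I ij) ->.
    by rewrite preimage_set0 set0I.
  rewrite measure_bigcup //; last 2 first.
  + by move=> k _; case: (hF k).
  + apply/trivIsetP => i j _ _ ij.
    by rewrite -preimage_setI; move/trivIsetP: tF => /(_ i j Logic.I Logic.I ij) ->; rewrite preimage_set0.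
  rewrite -nneseriesZl //.
  by apply: eq_eseriesr => k _; case: (hF k).
Qed.

Section SigmaAlgebra.
Variables (U : Type) (Sg : set (set U)).
Hypothesis sSg : sigma_algebra setT Sg.

Lemma sigma_setT : Sg setT.
Proof. by have [S0 SC _] := sSg; rewrite -[setT]setD0; exact: (SC _ S0). Qed.

Lemma sigma_setI C D : Sg C -> Sg D -> Sg (C `&` D).
Proof.
move=> hC hD; have [S0 SC SU] := sSg.
rewrite -[C `&` D]setCK setCI -!setTD; apply: (SC).
by rewrite -bigcup2E; apply: SU => -[|[|k]] //=; exact: (SC).
Qed.

Lemma sigma_setU C D : Sg C -> Sg D -> Sg (C `|` D).
Proof.
move=> hC hD; have [S0 _ SU] := sSg.
by rewrite -bigcup2E; apply: SU => -[|[|k]] //=.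
Qed.

Lemma sigma_all (I : eqType) (K : seq I) (F : I -> set U) :
  (forall i, i \in K -> Sg (F i)) -> Sg [set u | forall i, i \in K -> F i u].
Proof.
elim: K => [|i K IH] hF.
  rewrite (_ : [set _ | _] = setT); first exact: sigma_setT.
  by apply/seteqP; split.
rewrite (_ : [set _ | _] = F i `&` [set u | forall j, j \in K -> F j u]).
  apply: sigma_setI; first exact/hF/mem_head.
  by apply: IH => j jK; apply: hF; rewrite inE jK orbT.
apply/seteqP; split=> u /=.
  by move=> h; split=> [|j jK]; apply: h; rewrite ?mem_head // inE jK orbT.
by move=> [h1 h2] j; rewrite inE => /orP[/eqP->|/h2].
Qed.

(** There are countably many values for the finitely many coordinates involved;
    once these are fixed, the set is trivial. *)
Lemma depends_measurable (I : choiceType) (c : U -> I -> nat) (K : seq I)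
    (A : set (I -> nat)) :
  (forall i a, i \in K -> Sg [set u | c u i = a]) ->
  depends (mem K) A -> Sg [set u | A (c u)].
Proof.
have [S0 _ SU] := sSg.
elim: K A => [|i K IH] A hc hA.
  have [h|h] := pselect (A (fun=> 0%N)).
    rewrite (_ : [set _ | _] = setT); first exact: sigma_setT.
    by apply/seteqP; split=> u //= _; rewrite (hA _ (fun=> 0%N)).
  rewrite (_ : [set _ | _] = set0) //; apply/seteqP; split=> u //=.
  by rewrite (hA _ (fun=> 0%N)).
rewrite (_ : [set u | A (c u)] =
    \bigcup_a ([set u | c u i = a] `&` [set u | A (upd (c u) i a)])).
  apply: SU => a; apply: sigma_setI; first by apply: hc; exact: mem_head.
  apply: (IH (fun z => A (upd z i a))) => [j b jK|z z' e].
    by apply: hc; rewrite inE jK orbT.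
  by apply: hA => j; rewrite /upd /= inE; case: eqVneq => //= _; exact: e.
have updE (z : I -> nat) a : z i = a -> upd z i a = z.
  by move=> <-; apply/funext => j; rewrite /upd; case: eqP => // ->.
apply/seteqP; split=> u /=.
  by move=> h; exists (c u i) => //; split=> //=; rewrite updE.
by move=> [a _ [/= h1]]; rewrite updE.
Qed.

End SigmaAlgebra.

Definition cylinders : set (set (nat -> nat)) := [set B | exists K : seq nat, depends (mem K) B].

(** The type of the randomness at one site, with the product sigma-algebra. *)
Definition noise := g_sigma_algebraType cylinders.

Lemma cylindersI : setI_closed cylinders.
Proof.
move=> A B [K hK] [K' hK']; exists (K ++ K') => z z' e; rewrite /setI /=.
rewrite (hK z z'); last by move=> i iK; apply: e; rewrite /= mem_cat; apply/orP; left.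
by rewrite (hK' z z') // => i iK; apply: e; rewrite /= mem_cat; apply/orP; right.
Qed.

Section Iid.
Variables (R : realType) (V : countType) (N : nat -> nat) (mu : nat -> nat -> R).
Local Notation idx := (V * nat)%type.
Let N' (i : idx) := N i.2.
Let mu' (i : idx) := mu i.2.

Variable Z : idx -> R -> nat.
Hypothesis hZ : forall (A : set (idx -> nat)) (K : seq idx) (z : idx -> nat), uniq K ->
    depends (mem K) A ->
    measurable [set x | A (Z^~ x)] /\
    unitP R [set x | A (Z^~ x)] = (avg N' mu' K (fun z => (`[< A z >])%:R) z)%:E.

Let Y (v : V) (x : R) : noise := fun k => Z (v, k) x.

Lemma noise_cyl v (B : set noise) (K : seq nat) : uniq K -> depends (mem K) (B : set (nat -> nat)) ->
  measurable (Y v @^-1` B) /\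
  unitP R (Y v @^-1` B) = (avg N mu K (fun z => (`[< B z >])%:R) (fun=> 0%N))%:E.
Proof.
move=> uK hB.
have uKv : uniq (map (pair v) K) by rewrite map_inj_uniq // => a b [].
have hKv : depends (mem (map (pair v) K)) (fun z : idx -> nat => B (fun k => z (v, k))).
  by move=> z z' e; apply: hB => k kK; apply: e; exact: map_f.
have [mB pB] := hZ (fun=> 0%N) uKv hKv.
split=> //; rewrite [LHS]pB; congr EFin.
by apply: (@avg_map R nat idx (pair v) N mu N' mu' K (fun z => (`[< B z >])%:R) (fun=> 0%N)) => // a b [].
Qed.

Let cyl_uniq (B : set noise) : cylinders B ->
  exists2 K : seq nat, uniq K & depends (mem K) (B : set (nat -> nat)).
Proof.
move=> [K hK]; exists (undup K); first exact: undup_uniq.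
by apply: depends_sub hK => i; rewrite /= mem_undup.
Qed.

Lemma noise_law u v (B : set noise) : measurable B ->
  measurable (Y u @^-1` B) /\ unitP R (Y u @^-1` B) = unitP R (Y v @^-1` B).
Proof.
move=> mB; have cylP A : cylinders A -> [/\ measurable (Y u @^-1` A), measurable (Y v @^-1` A) &
     unitP R (Y u @^-1` A `&` setT) = (1%:E * unitP R (Y v @^-1` A))%E].
  move=> /cyl_uniq [K uK hK]; have [mA pA] := noise_cyl u uK hK.
  have [mA' pA'] := noise_cyl v uK hK.
  by split=> //; rewrite setIT mul1e pA pA'.
have [m1 _] := @law_ext R noise cylinders _ _ _ _ (unitP R) (unitP R) (Y u) (Y v) setT 1
  cylindersI measurableT (probability_setT (unitP R)) cylP B mB.
by rewrite setIT mul1e.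
Qed.

Lemma noise_indep_cyl (J : seq V) (B : V -> set noise) : uniq J -> (forall v, v \in J -> cylinders (B v)) ->
  unitP R [set x | forall v, v \in J -> B v (Y v x)] = (\prod_(v <- J) unitP R (Y v @^-1` B v))%E.
Proof.
move=> uJ hB; pose A (J : seq V) : set (idx -> nat) := fun z => forall v, v \in J -> B v (fun k => z (v, k)).
suff [K [uK hK e sK]] : exists K : seq idx, [/\ uniq K, depends (mem K) (A J),
    forall z, (avg N' mu' K (fun z => (`[< A J z >])%:R) z)%:E = (\prod_(v <- J) unitP R (Y v @^-1` B v))%E &
    forall i, i \in K -> i.1 \in J].
  by have [_ ->] := hZ (fun=> 0%N) uK hK; rewrite e.
elim: J uJ hB => [|v J IH] /= uJ hB.
  exists [::]; split=> //; first by move=> z z' _; apply/propext; split=> _ u.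
  by move=> z; rewrite big_nil /=; congr (_%:E); case: asboolP => // -[].
case/andP: uJ => vJ uJ; have hB' u : u \in J -> cylinders (B u) by move=> uJ'; apply: hB; rewrite inE uJ' orbT.
have [K [uK hK e sK]] := IH uJ hB'.
have /cyl_uniq [Kv uKv hKv] := hB v (mem_head _ _).
have [_ pv] := noise_cyl v uKv hKv.
exists (map (pair v) Kv ++ K); split.
- rewrite cat_uniq uK map_inj_uniq ?uKv ?andbT /=; last by move=> a b [].
  apply/hasPn => i iK; apply/mapP => -[k _ ik]; have := sK _ iK; rewrite ik /= => vJ'.
  by rewrite vJ' in vJ.
- move=> z z' ez.
  have AJ : A J z = A J z' by apply: hK => i iK; apply: ez; rewrite /= mem_cat; apply/orP; right.
  have Bv : B v (fun k => z (v, k)) = B v (fun k => z' (v, k)).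
    by apply: hKv => k kK; apply: ez; rewrite /= mem_cat map_f.
  have AE y : A (v :: J) y = (B v (fun k => y (v, k)) /\ A J y).
    apply/propext; split=> [h|[h1 h2] u]; last by rewrite inE => /orP[/eqP->|/h2].
    by split=> [|u uJ']; apply: h; rewrite ?mem_head // inE uJ' orbT.
  by rewrite !AE AJ Bv.
- move=> z; rewrite big_cons -(e z) pv -EFinM; congr EFin.
  rewrite avg_cat.
  transitivity (avg N' mu' (map (pair v) Kv) (fun z1 => avg N' mu' K (fun z => (`[< A J z >])%:R) z *
      (`[< B v (fun k => z1 (v, k)) >])%:R) z).
    apply: eq_avg => z1 _.
    have -> : avg N' mu' K (fun z => (`[< A J z >])%:R) z = avg N' mu' K (fun z => (`[< A J z >])%:R) z1 :> R.
      by apply: EFin_inj; rewrite !e.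
    rewrite [RHS]mulrC -avg_scale; apply: eq_avg => z2 ez2.
    have -> : B v (fun k => z1 (v, k)) = B v (fun k => z2 (v, k)).
      congr (B v _); apply/funext => k; rewrite ez2 //.
      by apply: contraNN vJ => /sK.
    rewrite -natrM mulnb; congr (nat_of_bool _)%:R; rewrite -asbool_and; apply: asbool_equiv_eq.
    split=> [h|[h1 h2] u]; last by rewrite inE => /orP[/eqP->|/h2].
    by split=> [|u uJ']; apply: h; rewrite ?mem_head // inE uJ' orbT.
  rewrite avg_scale mulrC; congr (_ * _).
  have fI : injective (pair v : nat -> idx) by move=> a b [].
  rewrite (@avg_map R nat idx (pair v) N mu N' mu' Kv (fun z => (`[< B v z >])%:R) z) //.
  have hh : depends (mem Kv) (fun z => (`[< B v z >])%:R : R).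
    by move=> z1 z2 e12; rewrite (hKv z1 z2).
  have := avg_depends N mu (K := Kv) hh; apply.
  by move=> i /andP[/= ->].
- move=> [w k]; rewrite mem_cat inE => /orP[/mapP[k' _ [-> _]]|/sK /= ->]; rewrite ?eqxx ?orbT //.
Qed.

(** The sites are promoted one at a time from cylinders to measurable sets, by
    [law_ext] with [E] the event at the other sites. *)
Lemma noise_indep (J1 J2 : seq V) (B : V -> set noise) : uniq (J1 ++ J2) ->
  (forall v, v \in J1 -> measurable (B v)) -> (forall v, v \in J2 -> cylinders (B v)) ->
  unitP R [set x | forall v, v \in J1 ++ J2 -> B v (Y v x)] =
  (\prod_(v <- J1 ++ J2) unitP R (Y v @^-1` B v))%E.
Proof.
elim: J1 J2 B => [|v J IH] J2 B; first by move=> *; exact: noise_indep_cyl.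
rewrite cat_cons => uJ mB cB; pose E := [set x | forall u, u \in J ++ J2 -> B u (Y u x)].
have /= /andP[vJ uJ'] := uJ.
have mB' u : u \in J ++ J2 -> measurable (B u).
  rewrite mem_cat => /orP[uJ1|/cB]; first by apply: mB; rewrite inE uJ1 orbT.
  exact: sub_sigma_algebra.
have mE : measurable E.
  rewrite (_ : E = \bigcap_(u in [set u | u \in J ++ J2]) (Y u @^-1` B u)).
    apply: fin_bigcap_measurable; first exact: finite_seq.
    by move=> u /= uJ2; apply: (noise_law u u _).1; exact: mB'.
  by apply/seteqP; split=> x /=.
have PE : unitP R E = (fine (unitP R E))%:E by rewrite fineK // fin_num_measure.
suff cylP A : cylinders A -> [/\ measurable (Y v @^-1` A), measurable (Y v @^-1` A) &
     unitP R (Y v @^-1` A `&` E) = ((fine (unitP R E))%:E * unitP R (Y v @^-1` A))%E].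
  have [_ _ e] := @law_ext R noise cylinders _ _ _ _ (unitP R) (unitP R) (Y v) (Y v) E _
    cylindersI mE PE cylP (B v) (mB v (mem_head _ _)).
  rewrite -PE in e; rewrite big_cons -IH //; last by move=> u uJ1; apply: mB; rewrite inE uJ1 orbT.
  rewrite -/E muleC; apply: etrans e; congr (unitP R _); apply/seteqP; split=> x /=.
    by move=> h; split=> [|u uJ2]; apply: h; rewrite ?mem_head // inE uJ2 orbT.
  by move=> [h1 h2] u; rewrite inE => /orP[/eqP->|/h2].
move=> cA; have mA : measurable (Y v @^-1` A) by apply: (noise_law v v _).1; exact: sub_sigma_algebra.
split=> //; rewrite -PE.
pose B' u := if u == v then A else B u.
have BB' u : u \in J ++ J2 -> B' u = B u.
  by rewrite /B'; case: eqP => // ->; rewrite (negPf vJ).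
have B'v : B' v = A by rewrite /B' eqxx.
have pJ : perm_eq (J ++ v :: J2) (v :: J ++ J2) by rewrite -cat1s perm_catCA.
have := IH (v :: J2) B'; rewrite (perm_uniq pJ) (perm_big _ pJ) /= => /(_ uJ).
rewrite big_cons B'v => IH'.
have <- : (\prod_(j <- J ++ J2) unitP R (Y j @^-1` B' j))%E = unitP R E.
  rewrite /E IH //; last by move=> u uJ1; apply: mB; rewrite inE uJ1 orbT.
  by rewrite big_seq [RHS]big_seq; apply: eq_bigr => u uJ2; rewrite BB'.
rewrite muleC -IH'.
- congr (unitP R _); apply/seteqP; split=> x /=.
    move=> [h1 h2] u; rewrite (perm_mem pJ) inE; case: (eqVneq u v) => [->|uv] /=.
      by rewrite B'v.
    by move=> uJ2; rewrite BB' //; exact: h2.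
  move=> h; split=> [|u uJ2].
    by have := h v; rewrite B'v; apply; rewrite (perm_mem pJ) mem_head.
  by rewrite -BB' //; apply: h; rewrite (perm_mem pJ) inE uJ2 orbT.
- by move=> u uJ1; rewrite BB' ?mem_cat ?uJ1 //; apply: mB; rewrite inE uJ1 orbT.
- move=> u; rewrite inE => /orP[/eqP->|uJ1]; first by rewrite B'v.
  by rewrite BB' ?mem_cat ?uJ1 ?orbT //; exact: cB.
Qed.

End Iid.

(** * The limit of the dynamics as a coding *)

Lemma partition_prob (R : realType) (dd : measure_display) (T : measurableType dd)
    (P : probability T R) (F : finType) (f : T -> F) (E : set T) :
  measurable E -> (forall a, measurable (f @^-1` [set a])) ->
  P E = (\sum_a P (E `&` f @^-1` [set a]))%E.
Proof.
move=> mE mf; have -> : E = \bigcup_(a in [set` enum F]) (E `&` f @^-1` [set a]).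
  apply/seteqP; split=> w; last by move=> [a _ []].
  by move=> Ew; exists (f w) => //=; rewrite mem_enum.
rewrite measure_fin_bigcup //=.
- rewrite -setI_bigcupr; have -> : \bigcup_(a in [set` enum F]) f @^-1` [set a] = setT.
    by apply/seteqP; split=> w // _; exists (f w) => //=; rewrite mem_enum.
  rewrite setIT; rewrite fsbig_finite //=.
  rewrite (perm_big (enum F)) /=; first by rewrite big_enum.
  apply: uniq_perm; rewrite ?fset_uniq ?enum_uniq // => a.
  rewrite in_fset_set; last exact: finite_finset.
  by apply/idP/idP; rewrite inE.
- move=> a b _ _ [w [[_ <-] [_ <-]]] //.
- by move=> a _; apply: measurableI.
Qed.

Lemma le_add_geometric (R : realType) (a b k q : R) : 0 <= q < 1 ->
  (forall t, a <= b + k * q ^+ t) -> a <= b.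
Proof.
move=> /andP[q0 q1] h.
have c : (fun t => b + k * q ^+ t) @ \oo --> b.
  rewrite -[X in _ --> X]addr0 -[X in _ --> _ + X](mulr0 k).
  apply: cvgD; first exact: cvg_cst.
  apply: cvgM; first exact: cvg_cst.
  by apply: cvg_expr; rewrite ger0_norm.
rewrite -(cvg_lim _ c) //; apply: limr_ge; first by apply: cvgP c.
exact: nearW.
Qed.

Section Factor.
Variables (R : realType) (d : nat) (S : finType) (s0 : S).
Local Notation cfg := (lattice d -> S).
Local Notation idx := (lattice d * nat)%type.
Implicit Types (u v w : lattice d) (x : cfg) (z : idx -> nat).

Variables (n m : nat -> nat) (B : nat -> nat -> cfg -> cfg) (succ : nat -> pred nat).
Variables (Nc : nat -> nat) (nu : nat -> nat -> R) (dens : nat -> R).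

Hypothesis Bloc : forall s a x x' w,
  (forall v, inball (n s).+1 v -> ~~ inball (n s) v -> x v = x' v) -> inball (n s) w ->
  B s a x w = B s a x' w.
Hypothesis Bsucc : forall s a x x' w, succ s a -> inball (radius n s + m s) w ->
  B s a x w = B s a x' w.
Hypothesis mn : forall s, (radius n s + m s <= n s)%N.

Local Notation sizes := (@sizes d Nc).
Local Notation laws := (@laws R d nu dens).
Local Notation coal := (coal n m succ).
Local Notation uncoal := (uncoal n m succ).
Local Notation history := (history n B).
Local Notation radius := (radius n).

Let x0 : cfg := fun=> s0.

(** The default value occurs only if no step coalesces, a null event. *)
Definition limit0 z : S :=
  if pselect (exists s, coal s z) is left e then history (ex_minn e).+1 x0 z 0 else s0.

Definition limit z : cfg := fun u => limit0 (shift u z).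

Lemma limit0E s t x z : coal s z -> (s < t)%N -> history t x z 0 = limit0 z.
Proof.
move=> cs st; rewrite /limit0; case: pselect => [e|[]]; last by exists s.
case: ex_minnP => s' cs' _.
rewrite (history_coal Bloc Bsucc mn x x0 cs st).
rewrite -(@history_coal _ _ _ _ _ _ Bloc Bsucc mn s (maxn s s').+1 x0 x0 z cs) ?ltnS ?leq_maxl //.
by rewrite (@history_coal _ _ _ _ _ _ Bloc Bsucc mn s' (maxn s s').+1 x0 x0 z cs') ?ltnS ?leq_maxr.
Qed.

Lemma limitE u t x z : ~~ uncoal t (shift u z) -> history t x z u = limit z u.
Proof.
rewrite -has_predC => /hasP[s]; rewrite mem_iota add0n /= negbK => st cs.
by rewrite /limit -(limit0E (translate u x) cs st) history_shift add0r.
Qed.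

Lemma limit_shift u z : limit (shift u z) = translate u (limit z).
Proof. by apply/funext => v; rewrite /limit /translate shiftD. Qed.

(** The slots that are inspected up to time [t] for the value at [v]. *)
Definition window v t : seq idx := [seq (u + v, k) | u <- ballseq d (radius t), k <- iota 0 t.*2].

Lemma mem_window v t w k : ((w, k) \in window v t) = inball (radius t) (w - v) && (k < t.*2)%N.
Proof.
apply/allpairsP/andP => [[[u k'] /= []]|[hw kt]].
  by rewrite mem_ballseq mem_iota add0n => hu /= kt [-> ->]; rewrite addrK.
by exists (w - v, k) => /=; rewrite mem_ballseq mem_iota add0n subrK.
Qed.

Lemma half_ltn k t : (k./2 < t)%N = (k < t.*2)%N.
Proof. by lia. Qed.

Lemma history_window v t x : depends (mem (window v t)) (fun z => history t x z v).
Proof.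
move=> z z' e; apply: history_local => // u k hu kt.
by apply: e; rewrite /= mem_window hu -half_ltn.
Qed.

Lemma coal_window v s : depends (mem (window v s.+1)) (fun z => coal s (shift v z)).
Proof.
move=> z z' e; apply: coal_local => // u k hu /eqP ks.
by apply: e; rewrite /= mem_window addrK hu -half_ltn ks ltnSn.
Qed.

Lemma window_mono v s t i : (s <= t)%N -> i \in window v s -> i \in window v t.
Proof.
move=> st; case: i => w k; rewrite !mem_window => /andP[h1 h2].
by rewrite (inball_le (radius_mono n st) h1) (leq_trans h2) // leq_double.
Qed.

Lemma uncoal_window v t : depends (mem (window v t)) (fun z => uncoal t (shift v z)).
Proof.
move=> z z' e; apply: eq_in_all => s; rewrite mem_iota add0n /= => st.
by congr (~~ _); apply: coal_window => i /= hi; apply: e; exact: window_mono hi.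
Qed.

(** Any coalescing step determines the limit, and what happens up to a given step
    depends on finitely many slots. *)
Lemma measurable_limit (U : Type) (Sg : set (set U)) (c : U -> idx -> nat) v (b : S) :
  sigma_algebra setT Sg -> (forall i a, Sg [set u | c u i = a]) ->
  Sg [set u | limit (c u) v = b].
Proof.
move=> sSg hc; have [S0 SC SU] := sSg.
have mc s : Sg [set u | coal s (shift v (c u))].
  apply: (depends_measurable sSg (A := fun z => coal s (shift v z)) (K := window v s.+1)) => //.
  by move=> z z' e; rewrite (coal_window e).
have mh s : Sg [set u | history s.+1 x0 (c u) v = b].
  apply: (depends_measurable sSg (A := fun z => history s.+1 x0 z v = b) (K := window v s.+1)) => //.
  by move=> z z' e; rewrite (history_window x0 e).
have E s z : coal s (shift v z) -> limit z v = history s.+1 x0 z v.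
  by move=> cs; rewrite /limit -(limit0E (translate v x0) cs (ltnSn s)) history_shift add0r.
rewrite (_ : [set u | _] =
  (\bigcup_s ([set u | coal s (shift v (c u))] `&` [set u | history s.+1 x0 (c u) v = b])) `|`
  ([set u | s0 = b] `&` (setT `\` \bigcup_s [set u | coal s (shift v (c u))]))).
  apply: (sigma_setU sSg); first by apply: SU => s; exact: sigma_setI.
  apply: (sigma_setI sSg); last by apply: (SC); exact: SU.
  have [<-|sb] := pselect (s0 = b).
    rewrite (_ : [set _ | _] = setT); first exact: sigma_setT.
    by apply/seteqP; split.
  by rewrite (_ : [set _ | _] = set0) //; apply/seteqP; split.
apply/seteqP; split=> u /=.
  have [[s cs] lb|nc] := pselect (exists s, coal s (shift v (c u))).
    by left; exists s => //; split; [exact: cs|exact: etrans (esym (E s _ cs)) lb].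
  rewrite {1}/limit /limit0; case: pselect => // _ sb; right; split=> //; split=> //.
  by move=> [s _ cs]; apply: nc; exists s.
move=> [[s _ [cs hs]]|[sb [_ nc]]]; first exact: etrans (E s _ cs) hs.
rewrite /limit /limit0; case: pselect => // -[s cs].
by case: nc; exists s.
Qed.

Variable pr : {fset lattice d} -> cfg -> R.
Hypothesis pr_marginal : forall (W W0 : {fset lattice d}) y, {subset W0 <= W} ->
  pr W0 y = \sum_(om : {ffun W -> S} | agree_on W0 (ext s0 om) y) pr W (ext s0 om).
Hypothesis pr_fset0 : forall x, pr fset0 x = 1.
Hypothesis pr_ge0 : forall W x, 0 <= pr W x.
Hypothesis pr_block : forall s v (W : {fset lattice d}) x,
  (forall u, inball (n s).+1 (u - v) -> u \in W) ->
  pr W x = pr (off_block n W s v) x * kernel n B Nc nu s (translate v x) (translate v x).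
Hypothesis nu1 : forall s, \sum_(a < Nc s) nu s a = 1.
Hypothesis lawP : is_law sizes laws.
Variable c : R.
Hypothesis c01 : 0 < c <= 1.
Hypothesis coal_ge : forall s z, c <= avg sizes laws (slots d n s) (fun z => (coal s z)%:R) z.

Variable Z : idx -> R -> nat.
Hypothesis hZ : forall (A : set (idx -> nat)) (K : seq idx) z, uniq K ->
    depends (mem K) A ->
    measurable [set x | A (Z^~ x)] /\
    unitP R [set x | A (Z^~ x)] = (avg sizes laws K (fun z => (`[< A z >])%:R) z)%:E.

Lemma measurable_coord i a : measurable [set w : R | Z i w = a].
Proof.
have [] // := hZ (A := fun z => z i = a) (K := [:: i]) (fun=> 0%N) isT.
by move=> z z' e; rewrite (e i) // /= inE.
Qed.

(** By homogeneity of the noise, the bound at the origin applies at every site. *)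
Lemma uncoal_prob v t : (unitP R [set w | uncoal t (shift v (Z^~ w))] <= ((1 - c) ^+ t)%:E)%E.
Proof.
pose f (i : idx) : idx := (i.1 + v, i.2).
have fI : injective f by move=> [u k] [u' k'] [/addIr -> ->].
have uK : uniq (map f (all_slots d n t)) by rewrite map_inj_uniq ?all_slots_uniq.
have hK : depends (mem (map f (all_slots d n t))) (fun z => uncoal t (shift v z) : Prop).
  move=> z z' e; congr is_true; apply: uncoal_local => // -[u k] uk.
  by apply: (e (f (u, k))); exact: map_f.
have [_ ->] := hZ (A := fun z => uncoal t (shift v z)) (fun=> 0%N) uK hK.
rewrite lee_fin.
have := @avg_map R idx idx f sizes laws sizes laws (all_slots d n t)
  (fun z => (uncoal t z)%:R) (fun=> 0%N) fI (fun=> erefl) (fun=> erefl).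
have -> : avg sizes laws (map f (all_slots d n t)) (fun z => (`[< uncoal t (shift v z) >])%:R) (fun=> 0%N)
  = avg sizes laws (map f (all_slots d n t)) (fun y => (uncoal t (y \o f))%:R) (fun=> 0%N) :> R.
  by apply: eq_avg => z' _; rewrite asboolb.
by move=> ->; exact: uncoal_avg_le.
Qed.

Definition fball r : {fset lattice d} := [fset v | v in ballseq d r]%fset.

Lemma mem_fball r v : (v \in fball r) = inball r v.
Proof.
rewrite /fball; apply/imfsetP/idP => [[u /=]|h]; first by rewrite mem_ballseq => ? ->.
by exists v; rewrite //= mem_ballseq.
Qed.

Definition big_window r t : seq idx :=
  [seq (u, k) | u <- ballseq d (r + radius t), k <- iota 0 t.*2].

Lemma mem_big_window r t w k :
  ((w, k) \in big_window r t) = inball (r + radius t) w && (k < t.*2)%N.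
Proof.
apply/allpairsP/andP => [[[u k'] /= []]|[hw kt]].
  by rewrite mem_ballseq mem_iota add0n => hu /= kt [-> ->].
by exists (w, k) => /=; rewrite mem_ballseq mem_iota add0n.
Qed.

Lemma big_window_uniq r t : uniq (big_window r t).
Proof.
apply: allpairs_uniq; rewrite ?ballseq_uniq ?iota_uniq //.
by move=> [u k] [u' k'] _ _ /= [-> ->].
Qed.

Lemma window_big r t v i : inball r v -> i \in window v t -> i \in big_window r t.
Proof.
move=> hv; case: i => w k; rewrite mem_window mem_big_window => /andP[hw ->].
by rewrite andbT -(subrK v w) addnC; exact: inballD.
Qed.

Definition limit_event r (y : cfg) : set R := [set w | forall v, inball r v -> limit (Z^~ w) v = y v].

Lemma measurable_limit_event r y : measurable (limit_event r y).
Proof.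
rewrite (_ : limit_event r y = \bigcap_(v in [set` ballseq d r]) [set w | limit (Z^~ w) v = y v]).
  apply: fin_bigcap_measurable; first exact: finite_seq.
  move=> v _; apply: (measurable_limit (c := fun a : R => Z^~ a) v (y v));
    last exact: measurable_coord.
  by split=> [|A mA|F mF]; [exact: measurable0|rewrite setTD; exact: measurableC|exact: bigcup_measurable].
apply/seteqP; split=> w /=; first by move=> h v /=; rewrite mem_ballseq; exact: h.
by move=> h v hv; apply: h; rewrite /= mem_ballseq.
Qed.

Lemma EX_le (W : {fset lattice d}) (h h' : cfg -> R) : (forall x, h x <= h' x) -> EX s0 pr W h <= EX s0 pr W h'.
Proof. by move=> e; apply: ler_sum => om _; rewrite ler_wpM2l. Qed.

(** Start the dynamics from the field itself: at time 0 the pattern has the same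
    probability as under the field, and it is a pattern of the limit unless some
    site of the ball has not coalesced. *)
Lemma limit_ge r (y : cfg) : pr (fball r) y <= fine (unitP R (limit_event r y)).
Proof.
have c1 : 0 <= 1 - c < 1.
  case/andP: c01 => c0 c1'; rewrite subr_ge0 c1' /=; by rewrite ltrBlDr ltrDl.
apply: (le_add_geometric c1 (k := (size (ballseq d r))%:R)) => t.
pose h x : R := (all (fun w => x w == y w) (ballseq d r))%:R.
pose W := fball (r + radius t).
have hW u : inball (r + radius t) u -> u \in W by rewrite mem_fball.
have hh x x' : (forall v, inball r v -> x v = x' v) -> h x = h x'.
  move=> e; congr (_%:R); congr nat_of_bool; apply: eq_in_all => v.
  by rewrite mem_ballseq => /e ->.
have -> : pr (fball r) y = EX s0 pr W h.
  rewrite (pr_marginal (W := W)); last first.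
    by move=> v; rewrite !mem_fball; apply: inball_le; exact: leq_addr.
  rewrite big_mkcond; apply: eq_bigr => om _; rewrite /h.
  have -> : agree_on (fball r) (ext s0 om) y = all (fun w => ext s0 om w == y w) (ballseq d r).
    apply/forallP/allP => [e v|e [v vW]].
      by rewrite mem_ballseq -mem_fball => vW; exact: (e (FSetSub vW)).
    by apply: e; rewrite mem_ballseq -mem_fball.
  by case: all; rewrite ?mulr1 ?mulr0.
have uK := big_window_uniq r t.
have hK v k : inball (r + radius t) v -> (k < t.*2)%N -> (v, k) \in big_window r t.
  by move=> hv kt; rewrite mem_big_window hv.
rewrite -(history_inv_sup pr_marginal pr_block Bloc nu1 (fun=> 0%N) lawP uK hK hW hh).
pose G z := all (fun w => ~~ uncoal t (shift w z) && (history t x0 z w == y w)) (ballseq d r).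
apply: (@le_trans _ _ (avg sizes laws (big_window r t)
   (fun z => (G z)%:R + \sum_(w <- ballseq d r) (uncoal t (shift w z))%:R) (fun=> 0%N))).
  apply: avg_mono => // z.
  have [/allP cz|] := boolP (all (fun w => ~~ uncoal t (shift w z)) (ballseq d r)).
    rewrite (@eq_EX _ _ _ s0 pr W _ (fun=> (G z)%:R)); last first.
      move=> x; congr (_%:R); congr nat_of_bool; apply: eq_in_all => w wr.
      by rewrite (cz w wr) (limitE x (cz w wr)) (limitE x0 (cz w wr)).
    rewrite (EX_const pr_marginal pr_fset0) lerDl; apply: sumr_ge0 => w _; exact: ler0n.
  rewrite -has_predC => /hasP[w wr]; rewrite /= negbK => uw.
  apply: (@le_trans _ _ (EX s0 pr W (fun=> 1))).
    by apply: EX_le => x; rewrite /h lern1 leq_b1.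
  rewrite (EX_const pr_marginal pr_fset0) -[leLHS]add0r lerD ?ler0n //.
  rewrite (bigD1_seq w) ?ballseq_uniq //= uw lerDl; apply: sumr_ge0 => *; exact: ler0n.
have avgD (f g : (idx -> nat) -> R) z : avg sizes laws (big_window r t) (fun z => f z + g z) z =
    avg sizes laws (big_window r t) f z + avg sizes laws (big_window r t) g z.
  have := avg_sum sizes laws (big_window r t) [:: true; false] (fun b => if b then f else g) z.
  rewrite !big_cons big_nil addr0 => <-; apply: eq_avg => z' _.
  by rewrite !big_cons big_nil addr0.
rewrite avgD avg_sum lerD //.
  have GD : depends (mem (big_window r t)) (fun z => G z : Prop).
    move=> z z' e; congr is_true; apply: eq_in_all => w; rewrite mem_ballseq => wr.
    have e' i : mem (window w t) i -> z i = z' i by move=> iw; apply: e; exact: window_big wr iw.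
    by rewrite (uncoal_window e') (history_window x0 e').
  have [mG pG] := hZ (A := fun z => G z) (fun=> 0%N) uK GD.
  rewrite -lee_fin fineK ?fin_num_measure //; last exact: measurable_limit_event.
  have -> : avg sizes laws (big_window r t) (fun z => (G z)%:R) (fun=> 0%N) =
     avg sizes laws (big_window r t) (fun z => (`[< G z >])%:R) (fun=> 0%N) :> R.
    by apply: eq_avg => z' _; rewrite asboolb.
  rewrite -pG; apply: le_measure; rewrite ?inE //; first exact: measurable_limit_event.
  move=> w /= /allP Gw v hv; have /andP[cv /eqP <-] := Gw v (etrans (mem_ballseq _ _) hv).
  by rewrite (limitE x0 cv).
have -> : (size (ballseq d r))%:R * (1 - c) ^+ t = \sum_(w <- ballseq d r) (1 - c) ^+ t.
  by rewrite big_const_seq count_predT iter_addr_0 mulr_natl.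
rewrite big_seq [leRHS]big_seq; apply: ler_sum => w; rewrite mem_ballseq => wr.
have UD : depends (mem (big_window r t)) (fun z => uncoal t (shift w z) : Prop).
  move=> z z' e; congr is_true; apply: uncoal_window => i iw; apply: e; exact: window_big wr iw.
have [_ pU] := hZ (A := fun z => uncoal t (shift w z)) (fun=> 0%N) uK UD.
have -> : avg sizes laws (big_window r t) (fun z => (uncoal t (shift w z))%:R) (fun=> 0%N) =
     avg sizes laws (big_window r t) (fun z => (`[< uncoal t (shift w z) >])%:R) (fun=> 0%N) :> R.
  by apply: eq_avg => z' _; rewrite asboolb.
by rewrite -lee_fin -pU uncoal_prob.
Qed.

Lemma sum_pr (W : {fset lattice d}) : \sum_(om : {ffun W -> S}) pr W (ext s0 om) = 1.
Proof.
rewrite -(pr_fset0 x0) (pr_marginal (W := W)) //.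
by apply: eq_bigl => om; apply/esym/forallP => -[].
Qed.

Lemma limit_eventE r (om : {ffun fball r -> S}) : limit_event r (ext s0 om) =
  (fun a : R => restr (fball r) (limit (Z^~ a))) @^-1` [set om].
Proof.
apply/seteqP; split=> w /= h.
  apply/ffunP => v; rewrite ffunE -(extE s0) -h //.
  by rewrite -mem_fball; exact: fsvalP.
by move=> v hv; rewrite -h ext_restr // mem_fball.
Qed.

(** Both sides are probabilities on the finite set of patterns, so the inequality
    [limit_ge] must be an equality. *)
Lemma limit_prob r (om : {ffun fball r -> S}) :
  unitP R (limit_event r (ext s0 om)) = (pr (fball r) (ext s0 om))%:E.
Proof.
have finP (o : {ffun fball r -> S}) : unitP R (limit_event r (ext s0 o)) \is a fin_num.
  by rewrite fin_num_measure //; exact: measurable_limit_event.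
rewrite -[LHS]fineK //; congr EFin; apply/eqP; rewrite -subr_eq0.
have : \sum_(o : {ffun fball r -> S}) (fine (unitP R (limit_event r (ext s0 o))) - pr (fball r) (ext s0 o)) = 0.
  rewrite sumrB sum_pr; apply/eqP; rewrite subr_eq0 -eqe -sumEFin; apply/eqP.
  rewrite -(probability_setT (unitP R)).
  rewrite (@partition_prob _ _ _ (unitP R) _ (fun a : R => restr (fball r) (limit (Z^~ a))) setT) //.
    by apply: eq_bigr => o _; rewrite fineK // setTI limit_eventE.
  by move=> o; rewrite -limit_eventE; exact: measurable_limit_event.
move=> /eqP; rewrite psumr_eq0; last by move=> o _; rewrite subr_ge0 limit_ge.
by move=> /allP/(_ om (mem_index_enum _)).
Qed.

Definition local_sets : set (set cfg) :=
  [set A | exists r, forall x y, (forall v, inball r v -> x v = y v) -> A x = A y].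

Lemma local_setsI : setI_closed local_sets.
Proof.
move=> A C [r hr] [r' hr']; exists (maxn r r') => x y e; rewrite /setI /=.
rewrite (hr x y); last by move=> v hv; apply: e; apply: inball_le hv; exact: leq_maxl.
by rewrite (hr' x y) // => v hv; apply: e; apply: inball_le hv; exact: leq_maxr.
Qed.

Lemma product_sigma_local (A : set cfg) :
  product_sigma d (@discrete_measurable S) A -> <<s local_sets >> A.
Proof.
apply: sub_sigma_algebra2 => _ [v [C _ ->]]; exists (l1norm v) => x y e /=.
by rewrite e //; exact: inball_l1.
Qed.

Lemma local_prob (dd : measure_display) (T : measurableType dd) (P : probability T R)
    (F : T -> cfg) r (A : set cfg) :
  (forall om : {ffun fball r -> S}, let E := (fun a => restr (fball r) (F a)) @^-1` [set om] in
      measurable E /\ P E = (pr (fball r) (ext s0 om))%:E) ->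
  (forall x y, (forall v, inball r v -> x v = y v) -> A x = A y) ->
  measurable (F @^-1` A) /\
  P (F @^-1` A) = (\sum_(om : {ffun fball r -> S} | `[< A (ext s0 om) >]) pr (fball r) (ext s0 om))%:E.
Proof.
move=> hE hA; pose f a := restr (fball r) (F a).
have fA a : A (F a) = A (ext s0 (f a)).
  by apply: hA => v hv; rewrite ext_restr // mem_fball.
have mA : measurable (F @^-1` A).
  rewrite (_ : _ @^-1` _ = \bigcup_(om in [set om | A (ext s0 om)]) (f @^-1` [set om])).
    by apply: fin_bigcup_measurable; [exact: finite_finset|move=> om _; exact: (hE om).1].
  apply/seteqP; split=> a /=; first by rewrite fA => h; exists (f a).
  by move=> [om /= h fa]; rewrite fA (_ : f a = om).
split=> //; rewrite (@partition_prob _ _ _ P _ f) //; last by move=> om; exact: (hE om).1.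
rewrite -sumEFin [RHS]big_mkcond; apply: eq_bigr => om _.
case: asboolP => h.
  rewrite -(hE om).2; congr (P _); apply/seteqP; split=> a /=; first by case.
  by move=> fa; split=> //; rewrite fA (_ : f a = om).
rewrite (_ : _ `&` _ = set0) ?measure0 //; apply/seteqP; split=> a //= [Fa fa].
by apply: h; rewrite -(fa : f a = om) -fA.
Qed.

Variables (dO : measure_display) (Om : measurableType dO) (P : probability Om R)
  (X : lattice d -> Om -> S).
Hypothesis hX : random_field (@discrete_measurable S) X.
Hypothesis prE : forall (W : {fset lattice d}) x,
  P [set w | forall v, v \in W -> X v w = x v] = (pr W x)%:E.

Lemma measurable_pattern (W : {fset lattice d}) x :
  measurable [set w | forall v, v \in W -> X v w = x v].
Proof.
rewrite (_ : [set _ | _] = \bigcap_(v in [set` W]) (X v @^-1` [set x v])) //.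
by apply: fin_bigcap_measurable => // v _; exact: hX.
Qed.

(** Events that depend on finitely many sites form a pi-system that generates the
    product sigma-algebra. *)
Lemma limit_law (A : set cfg) : product_sigma d (@discrete_measurable S) A ->
  unitP R [set a | A (limit (Z^~ a))] = P [set w | A (X^~ w)].
Proof.
move=> /product_sigma_local sA.
have hl (C : set cfg) : local_sets C -> [/\ measurable ((fun a : R => limit (Z^~ a)) @^-1` C),
    measurable ((fun a : Om => X^~ a) @^-1` C) &
    unitP R ((fun a : R => limit (Z^~ a)) @^-1` C `&` setT) =
    (1%:E * P ((fun a : Om => X^~ a) @^-1` C))%E].
  move=> [r hr].
  have [|m1 p1] := @local_prob _ _ (unitP R) (fun a : R => limit (Z^~ a)) r C _ hr.
    move=> om /=; rewrite -limit_eventE; split; first exact: measurable_limit_event.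
    exact: limit_prob.
  have [|m2 p2] := @local_prob _ _ P (fun a : Om => X^~ a) r C _ hr.
    move=> om /=; rewrite (_ : _ @^-1` _ = [set w | forall v, v \in fball r -> X v w = ext s0 om v]).
      by split; [exact: measurable_pattern|exact: prE].
    apply/seteqP; split=> w /=.
      by move=> <- v vr; rewrite ext_restr.
    by move=> h; apply/ffunP => v; rewrite ffunE h ?extE //; exact: fsvalP.
  by split=> //; rewrite setIT mul1e p1 p2.
have [_ _] := @law_ext R cfg local_sets _ _ _ _ (unitP R) P (fun a : R => limit (Z^~ a))
  (fun a : Om => X^~ a) setT 1 local_setsI measurableT (probability_setT (unitP R)) hl A sA.
by rewrite setIT mul1e.
Qed.

Definition flatten_noise (y : lattice d -> noise) : idx -> nat := fun i => (y i.1 : nat -> nat) i.2.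
Definition coding_map (y : lattice d -> noise) : cfg := limit (flatten_noise y).
Let Y (v : lattice d) (a : R) : noise := fun k => Z (v, k) a.

Lemma noise_iid : iid (unitP R) Y.
Proof.
pose N k := if odd k then Nc k./2 else 2%N.
pose mu k a := if odd k then nu k./2 a else if a == 0%N then 1 - dens k./2 else dens k./2.
have hZ' : forall (A : set (idx -> nat)) (K : seq idx) z, uniq K ->
    depends (mem K) A ->
    measurable [set x | A (Z^~ x)] /\
    unitP R [set x | A (Z^~ x)] =
    (avg (fun i : idx => N i.2) (fun i => mu i.2) K (fun z => (`[< A z >])%:R) z)%:E.
  exact: hZ.
split.
- by move=> v C mC; exact: (noise_law hZ' v v mC).1.
- move=> J C mC; have := noise_indep hZ' (J1 := J) (J2 := [::]) (B := C).
  by rewrite cats0; apply=> //; exact: fset_uniq.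
- by move=> u v C mC; exact: (noise_law hZ' u v mC).2.
Qed.

(** The coalescing step and the values it produces are read in the ball of radius
    [radius t] for the maximum norm, which lies in the ball of radius
    [d * radius t] for the norm that measures coding radii. *)
Lemma coding_map_radius t y : ~~ uncoal t (flatten_noise y) ->
  (coding_radius R coding_map y <= ((d * radius t)%:R)%:E)%E.
Proof.
rewrite -has_predC => /hasP[s]; rewrite mem_iota add0n /= negbK => st cs.
apply: ereal_inf_lbound; exists (d * radius t)%N => //= y' e.
have ez v k : inball (radius t) v -> flatten_noise y (v, k) = flatten_noise y' (v, k).
  by move=> hv; rewrite /flatten_noise /= e //; exact: l1_inball.
have cs' : coal s (flatten_noise y').
  rewrite -(@coal_local _ _ _ _ mn s (flatten_noise y)) // => v k hv _; apply: ez.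
  by apply: inball_le hv; exact: radius_mono.
rewrite /coding_map /limit !shift0 -(limit0E x0 cs st) -(limit0E x0 cs' st).
apply/esym/history_local => // v k; rewrite subr0 => hv _; exact: ez.
Qed.

Lemma measurable_coding_map (A : set cfg) : product_sigma d (@discrete_measurable S) A ->
  product_sigma d (@measurable _ noise) (coding_map @^-1` A).
Proof.
pose Sg := product_sigma d (@measurable _ noise).
have sSg : sigma_algebra setT Sg by exact: smallest_sigma_algebra.
have [S0 SC SU] := sSg.
move: A; apply: smallest_sub => [|_ [v [C _ ->]]].
  split; first exact: S0.
    by move=> A hA; rewrite setTD; have := SC _ hA; rewrite setTD.
  by move=> F hF; exact: (SU (fun k => coding_map @^-1` F k)).
have mb b : Sg [set y | coding_map y v = b].
  apply: (measurable_limit (c := flatten_noise)) => // -[u k] a.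
  apply: sub_sigma_algebra; exists u; exists [set y : noise | (y : nat -> nat) k = a] => //.
  apply: sub_sigma_algebra; exists [:: k] => y y' e /=.
  by rewrite (e k) //= inE.
rewrite (_ : _ @^-1` _ = \bigcup_k (if choice.unpickle k is Some b then
    (if `[< C b >] then [set y | coding_map y v = b] else set0) else set0)).
  by apply: SU => k; case: (choice.unpickle k) => // b; case: ifP.
apply/seteqP; split=> y /=.
  by move=> h; exists (choice.pickle (coding_map y v)) => //; rewrite choice.pickleK asboolT.
move=> [k _]; case: (choice.unpickle k) => // b; case: asboolP => // h ->; exact: h.
Qed.

Lemma finitary_factor :
  exists (dT : measure_display) (T : measurableType dT)
    (dO' : measure_display) (Om' : measurableType dO') (Q : probability Om' R)
    (Y : lattice d -> Om' -> T) (phi : (lattice d -> T) -> (lattice d -> S)),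
    [/\ iid Q Y, coding Q Y P X phi &
      forall t, exists E : set Om', [/\ measurable E, (Q E <= ((1 - c) ^+ t)%:E)%E &
        forall a, ~ E a -> (coding_radius R phi (Y^~ a) <= ((d * radius t)%:R)%:E)%E]].
Proof.
exists _, noise, _, _, (unitP R), Y, coding_map; split; first exact: noise_iid.
- split.
  + move=> A hA.
    exact: measurable_coding_map.
  + move=> u y; rewrite /coding_map -limit_shift; congr limit.
  + by move=> A hA; exact: limit_law.
- move=> t; exists [set a | uncoal t (Z^~ a)]; split.
  + have UD : depends (mem (all_slots d n t)) (fun z => uncoal t z : Prop).
      by move=> z z' e; congr is_true; exact: uncoal_local.
    by have [] := hZ (A := fun z => uncoal t z) (fun=> 0%N) (all_slots_uniq d n t) UD.
  + have := uncoal_prob 0 t; rewrite (_ : [set w | _] = [set a | uncoal t (Z^~ a)]) //.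
    by apply/seteqP; split=> a /=; rewrite shift0.
  + by move=> a /= /negP nu'; exact: coding_map_radius.
Qed.

End Factor.

(** * Conditional laws of a Markov field *)

Section MarkovBlocks.
Variables (R : realType) (d : nat) (S : finType) (s0 : S).
Variables (dO : measure_display) (Om : measurableType dO) (P : probability Om R)
  (X : lattice d -> Om -> S).
Hypothesis hX : random_field (@discrete_measurable S) X.
Hypothesis hinv : translation_invariant (@discrete_measurable S) P X.
Hypothesis hmrf : markov_random_field P X.
Local Notation cfg := (lattice d -> S).
Implicit Types (W V U : {fset lattice d}) (x y : cfg) (u v : lattice d).

Definition pattern W x : set Om := [set w | forall v, v \in W -> X v w = x v].

Definition pattern_prob W x : R := fine (P (pattern W x)).

Lemma measurable_pat W x : measurable (pattern W x).
Proof. exact: measurable_pattern. Qed.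

Lemma prE W x : P (pattern W x) = (pattern_prob W x)%:E.
Proof. by rewrite fineK // fin_num_measure //; exact: measurable_pat. Qed.

Lemma pr_ge0 W x : 0 <= pattern_prob W x.
Proof. by rewrite -lee_fin -prE measure_ge0. Qed.

Lemma pr_fset0 x : pattern_prob fset0 x = 1.
Proof.
apply: EFin_inj; rewrite -prE -(probability_setT P); congr (P _).
by apply/seteqP; split=> w // _ v; rewrite inE.
Qed.

Lemma restr_patternE W (om : {ffun W -> S}) :
  (fun w => restr W (X^~ w)) @^-1` [set om] = pattern W (ext s0 om).
Proof.
apply/seteqP; split=> w /=.
  by move=> <- v vr; rewrite ext_restr.
by move=> h; apply/ffunP => v; rewrite ffunE h ?extE //; exact: fsvalP.
Qed.

Lemma event_eqE W x : event_eq X (restr W x) = pattern W x.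
Proof.
apply/seteqP; split=> w /= h.
  by move=> v vW; have /ffunP/(_ (FSetSub vW)) := h; rewrite !ffunE.
by apply/ffunP => v; rewrite !ffunE h //; exact: fsvalP.
Qed.

Lemma measurable_event W (t : {ffun W -> S}) : measurable (event_eq X t).
Proof. by rewrite [event_eq _ _]restr_patternE; exact: measurable_pat. Qed.

Lemma pr_marginal W W0 y : {subset W0 <= W} ->
  pattern_prob W0 y = \sum_(om : {ffun W -> S} | agree_on W0 (ext s0 om) y) pattern_prob W (ext s0 om).
Proof.
move=> sW; apply: EFin_inj; rewrite -prE.
rewrite (@partition_prob _ _ _ P _ (fun w => restr W (X^~ w))); last 2 first.
- exact: measurable_pat.
- by move=> om; rewrite restr_patternE; exact: measurable_pat.
rewrite -sumEFin [RHS]big_mkcond; apply: eq_bigr => om _; rewrite restr_patternE.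
case: ifPn => [/forallP ag|nag].
  rewrite -prE; congr (P _); apply/seteqP; split=> w; first by case.
  move=> h; split=> // v vW0; rewrite h; last exact: sW.
  by have /eqP := ag (FSetSub vW0).
rewrite (_ : _ `&` _ = set0) ?measure0 //; apply/seteqP; split=> w //= [h1 h2].
move/negP: nag; apply; apply/forallP => v; rewrite -h2; last exact/sW/fsvalP.
by rewrite h1 //; exact: fsvalP.
Qed.

Lemma pr_mono W W0 x : {subset W0 <= W} -> pattern_prob W x <= pattern_prob W0 x.
Proof.
move=> sW; rewrite -lee_fin -!prE; apply: le_measure; rewrite ?inE; try exact: measurable_pat.
by move=> w h v vW0; apply: h; exact: sW.
Qed.

Definition unshift v W : {fset lattice d} := [fset (u - v) | u in W]%fset.

Lemma mem_unshift v W u : (u \in unshift v W) = (u + v \in W).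
Proof.
apply/imfsetP/idP => [[w /= wW ->]|h]; first by rewrite subrK.
by exists (u + v) => //=; rewrite addrK.
Qed.

Lemma pattern_sigma W x :
  product_sigma d (@discrete_measurable S) [set y | forall v, v \in W -> y v = x v].
Proof.
apply: (@sigma_all _ _ (smallest_sigma_algebra _ _) _ _ (fun v => [set y | y v = x v])) => v _.
by apply: sub_sigma_algebra; exists v; exists [set x v].
Qed.

Lemma pr_shift v W x : pattern_prob W x = pattern_prob (unshift v W) (translate v x).
Proof.
have := hinv v (pattern_sigma (unshift v W) (translate v x)).
rewrite /= => e; rewrite /pattern_prob; congr fine; apply: etrans e; congr (P _).
apply/seteqP; split=> w h u; last first.
  by move=> uW; have := h (u - v); rewrite mem_unshift subrK => /(_ uW); rewrite /translate subrK.
by rewrite mem_unshift /translate => uW; exact: h.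
Qed.

Lemma sigma_pattern (A : set (lattice d)) W x : (forall v, v \in W -> A v) ->
  sigma_field X A (pattern W x).
Proof.
move=> WA.
apply: (@sigma_all _ _ (smallest_sigma_algebra _ _) _ _ (fun v => X v @^-1` [set x v])) => v vW.
by apply: sub_sigma_algebra; exists v; [exact: WA|exists [set x v]].
Qed.

(** Conditionally on the boundary, the pattern in [V] is independent of the pattern
    off [V], and the latter contains the boundary. *)
Lemma pr_markov V W x : {subset V <= W} -> {subset boundary V <= W} ->
  0 < pattern_prob (boundary V) x ->
  pattern_prob W x = pattern_prob [fset u in W | u \notin V]%fset x *
    cond_prob P (pattern V x) (event_eq X (restr (boundary V) x)).
Proof.
move=> sV sB p0; set W' := [fset u in W | u \notin V]%fset.
have mW' u : (u \in W') = (u \in W) && (u \notin V) by rewrite !inE.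
have bW' u : u \in boundary V -> u \in W'.
  by move=> ub; rewrite mW' (sB u ub); have /in_boundary [] := ub.
have := hmrf (sigma_pattern (A := [set` V]) (W := V) x (fun v h => h))
   (sigma_pattern (A := ~` [set` V]) (W := W') x _) (t := restr (boundary V) x).
rewrite event_eqE prE lte_fin => /(_ _ p0) H.
have {H} H : cond_prob P (pattern V x `&` pattern W' x) (pattern (boundary V) x) =
    cond_prob P (pattern V x) (pattern (boundary V) x) *
    cond_prob P (pattern W' x) (pattern (boundary V) x).
  by apply: H => v; rewrite mW' => /andP[_ /negP].
move: H; rewrite {1 3}/cond_prob.
have -> : pattern V x `&` pattern W' x `&` pattern (boundary V) x = pattern W x.
  apply/seteqP; split=> w.
    move=> [[h1 h2] _] v vW; case: (boolP (v \in V)) => vV; first exact: h1.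
    by apply: h2; rewrite mW' vW.
  move=> h; split; [split|] => v hv; apply: h; first exact: sV.
    by move: hv; rewrite mW' => /andP[].
  exact: sB.
have -> : pattern W' x `&` pattern (boundary V) x = pattern W' x.
  by apply/seteqP; split=> w; [case|move=> h; split=> // v hv; apply: h; exact: bW'].
rewrite -/(pattern_prob W x) -/(pattern_prob W' x) -/(pattern_prob (boundary V) x) => H.
have pn : pattern_prob (boundary V) x != 0 by rewrite gt_eqF.
apply: (mulIf (invr_neq0 pn)); rewrite H; ring.
Qed.

Lemma sub_fball W : exists r, {subset W <= fball d r}.
Proof.
exists (\max_(v <- enum_fset W) l1norm v)%N => v vW; rewrite mem_fball; apply: inball_l1.
exact: (@leq_bigmax_seq _ _ xpredT (fun v => l1norm v)).
Qed.

(** The configurations that show a pattern of probability zero in some ball form a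
    null set, being covered by countably many null events.  An event of positive
    probability therefore contains a configuration of the support. *)
Lemma support_pos W (t : {ffun W -> S}) : (0 < P (event_eq X t))%E -> support_on P X W t.
Proof.
move=> Pt; apply: contrapT => nt.
pose N r := [set w | pattern_prob (fball d r) (X^~ w) = 0].
have prX r w : pattern_prob (fball d r) (X^~ w) = pattern_prob (fball d r) (ext s0 (restr (fball d r) (X^~ w))).
  by congr (fine (P _)); apply/seteqP; split=> a h v vr; rewrite h // ext_restr.
have NE r : N r = \bigcup_(om in [set om : {ffun fball d r -> S} | pattern_prob (fball d r) (ext s0 om) = 0])
    pattern (fball d r) (ext s0 om).
  apply/seteqP; split=> w; rewrite /N /=.
    by move=> h; exists (restr (fball d r) (X^~ w)); rewrite /= -?restr_patternE -?prX.
  by move=> [om /= h]; rewrite -restr_patternE => e; rewrite prX (e : restr _ _ = om).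
have mN r : measurable (N r).
  by rewrite NE; apply: fin_bigcup_measurable; [exact: finite_finset|move=> om _; exact: measurable_pat].
have PN r : P (N r) = 0%E.
  rewrite (@partition_prob _ _ _ P _ (fun w => restr (fball d r) (X^~ w))) //; last first.
    by move=> om; rewrite restr_patternE; exact: measurable_pat.
  apply: big1 => om _; apply/eqP; rewrite eq_le measure_ge0 andbT.
  have [p0|p0] := eqVneq (pattern_prob (fball d r) (ext s0 om)) 0.
    rewrite -[leRHS]/(0%:E) -p0 -prE; apply: le_measure; rewrite ?inE; last first.
      by move=> w [_]; rewrite restr_patternE.
    + exact: measurable_pat.
    + by apply: measurableI => //; rewrite restr_patternE; exact: measurable_pat.
  rewrite (_ : _ `&` _ = set0) ?measure0 //; apply/seteqP; split=> w //= [h e].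
  by move/eqP: p0; apply; rewrite -e -prX.
have sub : event_eq X t `<=` \bigcup_r N r.
  move=> w wt; apply: contrapT => nN; apply: nt; exists (X^~ w) => // V.
  have [r Vr] := sub_fball V; rewrite event_eqE prE lte_fin.
  apply: (lt_le_trans _ (pr_mono (X^~ w) Vr)); rewrite lt_def pr_ge0 andbT.
  by apply/eqP => h; apply: nN; exists r.
have neg : P.-negligible (event_eq X t).
  apply: (negligibleS sub); apply: negligible_bigcup => r.
  by exists (N r); split; [exact: mN|exact: PN|].
by rewrite (measure_negligible (measurable_event t) neg) ltxx in Pt.
Qed.

Lemma sum_cond_prob W (E : set Om) : measurable E -> P E != 0%E ->
  \sum_(h : {ffun W -> S}) cond_prob P (event_eq X h) E = 1.
Proof.
move=> mE PE; rewrite /cond_prob -mulr_suml.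
have fE : fine (P E) != 0 by rewrite fine_eq0 // fin_num_measure.
apply: (mulIf fE); rewrite divfK // mul1r; apply: EFin_inj.
rewrite -sumEFin fineK ?fin_num_measure //.
rewrite [RHS](@partition_prob _ _ _ P _ (fun w => restr W (X^~ w))) //; last exact: measurable_event.
apply: eq_bigr => h _; rewrite fineK; first by rewrite setIC.
by rewrite fin_num_measure //; apply: measurableI => //; exact: measurable_event.
Qed.

Section Scale.
Variables (n : nat) (delta : R).
Hypothesis delta01 : 0 < delta < 1.

Let V := box d (n%:R : R).
Let U := box d (delta * n%:R).
Let bd := boundary V.

Lemma mem_box_ball v : (v \in V) = inball n v.
Proof.
apply/idP/idP => [/in_box h|/inballP h].
  by apply/inballP => i; have := h i; rewrite -intr_norm -abszE ler_nat.
by apply/in_box => i; rewrite -intr_norm -abszE ler_nat.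
Qed.

Lemma box_sub : {subset U <= V}.
Proof.
move=> v /in_box h; apply/in_box => i; apply: le_trans (h i) _.
by case/andP: delta01 => _ d1; rewrite ler_piMl ?ler0n // ltW.
Qed.

Lemma bd_ball v : v \in bd -> inball n.+1 v && ~~ inball n v.
Proof.
move=> /in_boundary [vV [u uV uv]]; rewrite -mem_box_ball vV andbT.
rewrite -[v](subKr u) -addn1; apply: inballB; first by rewrite -mem_box_ball.
by apply: inball_l1; rewrite (eqP uv).
Qed.

Lemma ball_bd W v : (forall u, inball n.+1 u -> u \in W) -> v \in bd -> v \in W.
Proof. by move=> h /bd_ball/andP[/h]. Qed.

Lemma exists_boundary : exists t : {ffun bd -> S}, P (event_eq X t) != 0%E.
Proof.
apply: contrapT => ne.
have := @partition_prob _ _ _ P _ (fun w => restr bd (X^~ w)) setT measurableT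
  (@measurable_event bd).
rewrite probability_setT big1 => [/eqP|t _]; first by rewrite eqe oner_eq0.
by rewrite setTI; apply: contrapT => h; apply: ne; exists t; apply/eqP.
Qed.

Let t0 := sval (cid exists_boundary).

(** Impossible boundary conditions are replaced by a possible one: this gives a
    family of laws indexed by all boundary conditions, with the same minima as over
    the support. *)
Definition legal (t : {ffun bd -> S}) := if P (event_eq X t) == 0%E then t0 else t.

Lemma legalP t : P (event_eq X (legal t)) != 0%E.
Proof. by rewrite /legal; case: ifPn => // _; exact: (svalP (cid exists_boundary)). Qed.

Definition block_law (t : {ffun bd -> S}) (h : {ffun V -> S}) : R :=
  cond_prob P (event_eq X h) (event_eq X (legal t)).

Definition inner (h : {ffun V -> S}) : {ffun U -> S} := [ffun u : U => ext s0 h (val u)].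

Lemma cond_prob_ge0 (A E : set Om) : 0 <= cond_prob P A E.
Proof. by rewrite divr_ge0 // fine_ge0 // measure_ge0. Qed.

Lemma cond_marginalE t (o : {ffun U -> S}) :
  cond_marginal P X (legal t) o = \sum_(h | inner h == o) block_law t h.
Proof.
rewrite /cond_marginal /cond_law /block_law /cond_prob -mulr_suml; congr (_ / _).
set A := [set w | _].
have AE w : A w <-> inner (restr V (X^~ w)) = o.
  split=> [h|h u v uv].
    by apply/ffunP => u; rewrite ffunE -(h u (FSetSub (box_sub (valP u)))) // -(extE s0).
  by rewrite -h [RHS]ffunE uv extE.
have mA : measurable A.
  rewrite (_ : A = \bigcup_(h in [set h | inner h = o]) event_eq X h).
    by apply: fin_bigcup_measurable => [|h _]; [exact: finite_finset|exact: measurable_event].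
  apply/seteqP; split=> w /=; first by move=> /AE h; exists (restr V (X^~ w)).
  by move=> [h /= ho wh]; apply/AE; rewrite wh.
have mL := measurable_event (legal t).
apply: EFin_inj; rewrite fineK ?fin_num_measure //; last exact: measurableI.
rewrite -sumEFin (@partition_prob _ _ _ P _ (fun w => restr V (X^~ w))); last 2 first.
- exact: measurableI.
- exact: (@measurable_event V).
rewrite [RHS]big_mkcond; apply: eq_bigr => h _.
case: eqP => ho.
  rewrite fineK ?fin_num_measure //; last by apply: measurableI => //; exact: measurable_event.
  congr (P _); apply/seteqP; split=> w; first by move=> [[_ h2] h3].
  by move=> [h1 h2]; split=> //; split=> //; apply/AE; rewrite (_ : restr V (X^~ w) = h).
rewrite (_ : _ `&` _ = set0) ?measure0 //; apply/seteqP; split=> w //= [[/AE h1 _] h2].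
by apply: ho; rewrite -h2.
Qed.

Lemma gamma_le_overlap : gamma P X V U <= \sum_o overlap inner block_law o.
Proof.
rewrite /gamma [leLHS]big_mkcond; apply: ler_sum => o _; case: ifP => _; last first.
  by apply: overlap_ge0 => t h; exact: cond_prob_ge0.
apply/bigmin_geP; split=> [|t _]; first exact: bigmin_le_id.
rewrite -cond_marginalE; apply: bigmin_le_cond.
by rewrite inE; apply: support_pos; rewrite lt0e legalP measure_ge0.
Qed.

(** The resampling map of a single scale, with the properties that the dynamics
    requires: it reads only the boundary, ignores it on the inner box when
    successful, and follows the conditional law of the field. *)
Lemma scale_coupling : exists p : nat * (nat -> R) * (nat -> cfg -> cfg) * pred nat,
  let: (N, nu, B, succ) := p in
  [/\ (forall a, 0 <= nu a) /\ \sum_(a < N) nu a = 1,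
    forall a x x' w, (forall v, inball n.+1 v -> ~~ inball n v -> x v = x' v) ->
      inball n w -> B a x w = B a x' w,
    forall a x x' w, succ a -> w \in U -> B a x w = B a x' w,
    forall v W x, (forall u, inball n.+1 (u - v) -> u \in W) ->
      pattern_prob W x = pattern_prob [fset u in W | ~~ inball n (u - v)]%fset x *
       \sum_(a < N | all (fun w => B a (translate v x) w == translate v x w) (ballseq d n)) nu a &
    gamma P X V U <= \sum_(a < N | succ a) nu a].
Proof.
have [N [nu [F [ag [nu0 nu1 nuF agF ovl]]]]] := @coupling R _ _ _ inner block_law
  (fun t h => cond_prob_ge0 _ _)
  (fun t => sum_cond_prob V (measurable_event (legal t)) (legalP t)) t0.
exists (N, nu, fun a x => ext s0 (F a (restr bd x)), ag); split=> //.
- move=> a x x' w e _; congr (ext s0 (F a _) w); apply/ffunP => v; rewrite !ffunE.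
  by have /andP[h1 h2] := bd_ball (valP v); exact: e.
- move=> a x x' w sa wU.
  have /ffunP/(_ (FSetSub wU)) := agF a (restr bd x) (restr bd x') sa.
  by rewrite !ffunE.
- move=> v W x hW.
  rewrite (pr_shift v W) (pr_shift v [fset u in W | _]%fset).
  set y := translate v x; set W1 := unshift v W.
  have hW1 u : inball n.+1 u -> u \in W1 by move=> hu; rewrite mem_unshift hW // addrK.
  have -> : unshift v [fset u in W | ~~ inball n (u - v)]%fset = [fset u in W1 | u \notin V]%fset.
    apply/fsetP => u; rewrite mem_unshift !inE /= mem_unshift addrK.
    by rewrite mem_box_ball.
  have -> : \sum_(a < N | all (fun w => ext s0 (F a (restr bd y)) w == y w) (ballseq d n)) nu a =
      block_law (restr bd y) (restr V y).
    rewrite -nuF; apply: eq_bigl => a; apply/allP/eqP => [h|h w].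
      apply/ffunP => w; rewrite ffunE -(extE s0); apply/eqP/h.
      by rewrite mem_ballseq -mem_box_ball; exact: valP.
    by rewrite mem_ballseq -mem_box_ball => wV; rewrite h ext_restr.
  have sV : {subset V <= W1}.
    by move=> u; rewrite mem_box_ball => hu; apply: hW1; apply: inball_le hu.
  have sB : {subset bd <= W1} by move=> u /(ball_bd hW1).
  have [p0|p0] := eqVneq (pattern_prob bd y) 0.
    have -> : pattern_prob W1 y = 0 by apply/eqP; rewrite eq_le pr_ge0 andbT -p0 pr_mono.
    rewrite (_ : pattern_prob [fset u in W1 | u \notin V]%fset y = 0) ?mul0r //.
    apply/eqP; rewrite eq_le pr_ge0 andbT -p0; apply: pr_mono => u ub.
    by rewrite !inE /= (sB u ub); have /in_boundary [] := ub.
  rewrite (@pr_markov V W1 y) //; last by rewrite lt_def p0 pr_ge0.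
  rewrite /block_law /legal event_eqE prE eqe (negPf p0) event_eqE.
  by rewrite event_eqE.
- by apply: le_trans ovl; exact: gamma_le_overlap.
Qed.

End Scale.

End MarkovBlocks.

(** * Choice of the scales *)

Section Main.
Variables (R : realType) (d : nat) (S : finType) (s0 : S).
Variables (dO : measure_display) (Om : measurableType dO) (P : probability Om R)
  (X : lattice d -> Om -> S).
Hypothesis hX : random_field (@discrete_measurable S) X.
Hypothesis hinv : translation_invariant (@discrete_measurable S) P X.
Hypothesis hmrf : markov_random_field P X.

Let gam (delta : R) (k : nat) : R := gamma P X (box d (k%:R : R)) (box d (delta * k%:R)).

(** The centre is sought in a ball whose radius [m s] is half that of the inner box,
    so that the other half is left for the window.  This ball makes up a fixed
    fraction of the ball of radius [m s + 2 n s + 1] that has to be free of other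
    centres, whence the bound [c] below. *)
Lemma coding_of_scales (n : nat -> nat) (delta eps : R) : 0 < delta < 1 -> 0 < eps ->
  (forall s, (0 < n s)%N) ->
  (forall s, (radius n s)%:R <= delta * (n s)%:R / 2) ->
  (forall s, eps <= gam delta (n s)) ->
  exists q : R, 0 < q < 1 /\
  exists (dT : measure_display) (T : measurableType dT)
    (dO' : measure_display) (Om' : measurableType dO') (Q : probability Om' R)
    (Y : lattice d -> Om' -> T) (phi : (lattice d -> T) -> (lattice d -> S)),
    [/\ iid Q Y, coding Q Y P X phi &
      forall t, exists E : set Om', [/\ measurable E, (Q E <= (q ^+ t)%:E)%E &
        forall a, ~ E a -> (coding_radius R phi (Y^~ a) <= ((d * radius n t)%:R)%:E)%E]].
Proof.
move=> d01 eps0 n0 hr hg; have [del0 del1] := andP d01.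
pose sc s := cid (scale_coupling s0 hX hinv hmrf (n s) d01).
pose p s := sval (sc s); have hp s := svalP (sc s).
pose Nc s := (p s).1.1.1; pose nu s := (p s).1.1.2; pose B s := (p s).1.2.
pose succ s := (p s).2.
pose m s := Num.truncn (delta * (n s)%:R / 2).
have pos s : 0 <= delta * (n s)%:R / 2 by rewrite !mulr_ge0 // ltW.
have m_le s : (m s)%:R <= delta * (n s)%:R / 2 by rewrite /m truncn_le.
have m_gt s : delta * (n s)%:R / 2 < (m s).+1%:R by rewrite /m truncnS_gt.
have dn s : delta * (n s)%:R <= (n s)%:R by rewrite ler_piMl // ltW.
have rm s : (radius n s + m s)%:R <= delta * (n s)%:R :> R.
  by rewrite natrD; have := hr s; have := m_le s; lra.
have mn s : (radius n s + m s <= n s)%N by rewrite -(ler_nat R) (le_trans (rm s)).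
have hp' s : [/\ (forall a, 0 <= nu s a) /\ \sum_(a < Nc s) nu s a = 1,
    forall a x x' w, (forall v, inball (n s).+1 v -> ~~ inball (n s) v -> x v = x' v) ->
      inball (n s) w -> B s a x w = B s a x' w,
    forall a x x' w, succ s a -> w \in box d (delta * (n s)%:R) -> B s a x w = B s a x' w,
    forall v W x, (forall u, inball (n s).+1 (u - v) -> u \in W) ->
      pattern_prob P X W x = pattern_prob P X [fset u in W | ~~ inball (n s) (u - v)]%fset x *
       \sum_(a < Nc s | all (fun w => B s a (translate v x) w == translate v x w) (ballseq d (n s))) nu s a &
    gam delta (n s) <= \sum_(a < Nc s | succ s a) nu s a].
  by have := hp s; rewrite /Nc /nu /B /succ /p; case: (sval (sc s)) => [[[? ?] ?] ?].
pose M s := (m s + (n s).*2.+1)%N.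
pose dens s : R := (2 * (size (ballseq d (M s)))%:R)^-1.
have M0 s : 0 < (size (ballseq d (M s)))%:R :> R by rewrite size_ballseq ltr0n expn_gt0.
have M1 s : 1 <= (size (ballseq d (M s)))%:R :> R by rewrite size_ballseq ler1n expn_gt0.
have lawP : is_law (@sizes d Nc) (@laws R d nu dens).
  move=> [v k]; rewrite /sizes /laws /=; case: (odd k).
    by have [[h1 h2] _ _ _ _] := hp' k./2.
  have p0 : 0 <= dens k./2 by rewrite invr_ge0 mulr_ge0.
  have p1 : dens k./2 <= 1.
    by rewrite invf_le1 ?mulr_gt0 //; have := M1 k./2; lra.
  split; first by move=> a; case: eqP; rewrite // subr_ge0.
  by rewrite !big_ord_recl big_ord0 /= addr0 subrK.
(* The two balls have side lengths [2 m + 1 >= delta n / 2] and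
   [2 (m + 2 n + 1) + 1 <= 9 n]; the factor 1/4 comes from [coal_avg_ge]. *)
pose c := (delta / 18) ^+ d / 4 * eps.
have c0 : 0 < c by rewrite !mulr_gt0 ?invr_gt0 ?exprn_gt0 // divr_gt0.
have coal_ge s z : c <= avg (@sizes d Nc) (@laws R d nu dens) (slots d n s)
    (fun z => (coal n m succ s z)%:R) z.
  apply: le_trans (@coal_avg_ge R d n m succ Nc nu dens lawP mn s z erefl).
  have [_ _ _ _ hs] := hp' s.
  have r0 : 0 <= (delta / 18) ^+ d / 4 by rewrite !mulr_ge0 ?invr_ge0 ?exprn_ge0 // divr_ge0 // ltW.
  apply: (ler_pM r0 (ltW eps0)); last exact: le_trans (hg s) hs.
  rewrite invfM mulrCA mulrC ler_pM2l ?invr_gt0 //.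
  rewrite -/(M s) ler_pdivlMr ?M0 //.
  rewrite !size_ballseq !natrX -exprMn_comm; last exact: mulrC.
  have r1 : 0 <= delta / 18 by rewrite divr_ge0 // ltW.
  apply: lerXn2r; [by rewrite nnegrE mulr_ge0|by rewrite nnegrE|].
  have n1 : 1 <= (n s)%:R :> R by rewrite ler1n.
  have -> : ((M s + M s).+1)%:R = 2 * (m s)%:R + 4 * (n s)%:R + 3 :> R.
    by rewrite /M -natr1 !natrD -addnn -addn1 !natrD; ring.
  have -> : ((m s + m s).+1)%:R = 2 * (m s)%:R + 1 :> R.
    by rewrite -natr1 natrD; ring.
  have h1 := m_le s; have h3 := dn s.
  have h2 : delta * (n s)%:R / 2 < (m s)%:R + 1 by rewrite natr1; exact: m_gt.
  have h4 : 2 * (m s)%:R + 4 * (n s)%:R + 3 <= 9 * (n s)%:R :> R by lra.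
  apply: (@le_trans _ _ (delta / 18 * (9 * (n s)%:R))).
    by rewrite ler_wpM2l // ltW // divr_gt0.
  have m0 : 0 <= (m s)%:R :> R by [].
  lra.
have c1 : c <= 1.
  apply: le_trans (coal_ge 0 (fun=> 0%N)) _.
  rewrite -[leRHS](avg_const lawP (slots d n 0) _ (fun=> 0%N)).
  by apply: avg_mono => // z'; rewrite lern1 leq_b1.
(* [c] may be 1, but a positive ratio is wanted. *)
exists (1 - c / 2); split; first by lra.
have [Z hZ] := indep_family lawP.
have c2 : 0 < c / 2 <= 1 by lra.
have coal_ge2 s z : c / 2 <= avg (@sizes d Nc) (@laws R d nu dens) (slots d n s)
    (fun z => (coal n m succ s z)%:R) z.
  by apply: le_trans (coal_ge s z); lra.
have Bloc t a x x' w : (forall v, inball (n t).+1 v -> ~~ inball (n t) v -> x v = x' v) ->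
    inball (n t) w -> B t a x w = B t a x' w by have [_ h _ _ _] := hp' t; exact: h.
have Bsucc t a x x' w : succ t a -> inball (radius n t + m t) w -> B t a x w = B t a x' w.
  move=> sa hw; have [_ _ h _ _] := hp' t; apply: h => //.
  apply/in_box => i; apply: le_trans (rm t); rewrite -intr_norm -abszE ler_nat.
  by move/inballP: hw.
have pr_block t v W x : (forall u, inball (n t).+1 (u - v) -> u \in W) ->
    pattern_prob P X W x =
    pattern_prob P X (off_block n W t v) x * kernel n B Nc nu t (translate v x) (translate v x).
  by have [_ _ _ h _] := hp' t; exact: h.
have nu1 t : \sum_(a < Nc t) nu t a = 1 by have [[_ ->] _ _ _ _] := hp' t.
exact: (finitary_factor Bloc Bsucc mn (@pr_marginal R d S s0 dO Om P X hX) (pr_fset0 P hX)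
  (pr_ge0 P hX) pr_block nu1 lawP c2 coal_ge2 hZ hX (prE P hX)).
Qed.

End Main.

(** * Tails of the coding radius *)

Lemma pos_below (R : realType) (e : \bar R) : (0 < e)%E -> exists2 r : R, 0 < r & (r%:E < e)%E.
Proof.
case: e => [r|_|//]; last by exists 1; rewrite ?ltr01 // ltry.
by rewrite lte_fin => r0; exists (r / 2); rewrite ?lte_fin; lra.
Qed.

Lemma limn_esup_pos (R : realType) (u : nat -> R) : (0 < limn_esup (fun n => (u n)%:E))%E ->
  exists2 eps : R, 0 < eps & forall N, exists n, (N <= n)%N /\ eps <= u n.
Proof.
rewrite limn_esup_lim (cvg_lim _ (@cvg_esups_inf _ _)) // => /pos_below[r r0 hr].
exists r => // N; have : (r%:E < esups (fun n => (u n)%:E) N)%E.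
  by apply: lt_le_trans hr _; apply: ereal_inf_lbound; exists N.
move=> /ereal_sup_gt[_ [n /= Nn <-]]; rewrite lte_fin => h.
by exists n; split=> //; exact: ltW.
Qed.

Lemma limn_einf_pos (R : realType) (u : nat -> R) : (0 < limn_einf (fun n => (u n)%:E))%E ->
  exists2 eps : R, 0 < eps & exists N, forall n, (N <= n)%N -> eps <= u n.
Proof.
rewrite limn_einf_lim (cvg_lim _ (@cvg_einfs_sup _ _)) // => /ereal_sup_gt[_ [N _ <-]].
move=> /pos_below[r r0 hr]; exists r => //; exists N => n Nn.
rewrite -lee_fin; apply: le_trans (ltW hr) _.
by apply: ereal_inf_lbound; exists n.
Qed.

Section Tails.
Variables (R : realType) (d : nat) (S : finType).
Variables (dT : measure_display) (T : measurableType dT)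
    (dO' : measure_display) (Om' : measurableType dO') (Q : probability Om' R)
    (Y : lattice d -> Om' -> T) (phi : (lattice d -> T) -> (lattice d -> S)).
Variables (q : R) (D : nat -> nat).
Hypothesis q01 : 0 < q < 1.
Hypothesis tails : forall t, exists E : set Om', [/\ measurable E, (Q E <= (q ^+ t)%:E)%E &
        forall a, ~ E a -> (coding_radius R phi (Y^~ a) <= ((D t)%:R)%:E)%E].

Lemma finitary_of_tails : finitary Q Y phi.
Proof.
pose E t := sval (cid (tails t)).
have EP t : [/\ measurable (E t), (Q (E t) <= (q ^+ t)%:E)%E &
    forall a, ~ E t a -> (coding_radius R phi (Y^~ a) <= ((D t)%:R)%:E)%E] by exact: (svalP (cid (tails t))).
have mE : measurable (\bigcap_t E t) by apply: bigcap_measurableType => t _; case: (EP t).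
exists (\bigcap_t E t); split=> //.
- have QE : Q (\bigcap_t E t) = (fine (Q (\bigcap_t E t)))%:E by rewrite fineK // fin_num_measure.
  rewrite QE; congr EFin; apply/eqP; rewrite eq_le fine_ge0 ?measure_ge0 // andbT.
  apply: (@le_add_geometric _ _ 0 1 q); first by case/andP: q01 => /ltW -> ->.
  move=> t; rewrite add0r mul1r -lee_fin -QE; have [mEt QEt _] := EP t.
  by apply: le_trans QEt; apply: le_measure; rewrite ?inE //; exact: bigcap_inf.
- move=> a /= na t _; apply: contrapT => nE; apply: na.
  have [_ _ h] := EP t; apply: le_lt_trans (h _ nE) _; exact: ltry.
Qed.

(** With [al] the exponent for which [K ^ (- al) = q], the bound [q ^ t] at
    [r = A K ^ t] is a multiple of [r ^ (- al)]; the factor [q ^ (- 1)] pays for the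
    values of [r] between two consecutive powers, and [A ^ al] for [r <= A]. *)
Lemma power_law_of_tails (A K : R) : 1 <= A -> 1 < K ->
  (forall t, (D t)%:R <= A * K ^+ t) -> power_law_tails Q Y phi.
Proof.
move=> A1 K1 hD; have [q0 q1] := andP q01.
have lK : 0 < ln K by rewrite ln_gt0.
have lq : ln q < 0 by rewrite ln_lt0 ?q0.
pose al := - ln q / ln K.
have al0 : 0 < al by rewrite divr_gt0 // oppr_gt0.
have A0 : 0 < A by exact: lt_le_trans A1.
have lA : 0 <= ln A by rewrite ln_ge0.
have K0 : 0 < K by exact: lt_trans K1.
exists (expR (al * ln A - ln q)), al; split=> //; first exact: expR_gt0.
move=> r r0; have powE : r `^ (- al) = expR (- al * ln r) by rewrite /powR gt_eqF.
rewrite powE -expRD.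
have [rA|Ar] := leP r A.
  apply: (@le_trans _ _ (mu_ext Q setT)); first exact: le_mu_ext.
  have -> : mu_ext Q setT = 1%E by rewrite -(probability_setT Q); exact: measurable_mu_extE.
  rewrite lee_fin.
  rewrite -expR0 ler_expR.
  have : ln r <= ln A by rewrite ler_ln ?posrE.
  rewrite -(ler_pM2l al0) => h; lra.
have [t ht1 ht2] : exists2 t, A * K ^+ t < r & r <= A * K ^+ t.+1.
  have [t0 ht0] : exists t, r <= A * K ^+ t.
    apply: contrapT => nr; suff : A <= 0 by rewrite leNgt A0.
    apply: (@le_add_geometric _ _ 0 r K^-1).
      by rewrite invr_ge0 ltW //= invf_lt1.
    move=> t; rewrite add0r exprVn ler_pdivlMr ?exprn_gt0 //.
    by apply: ltW; rewrite ltNge; apply/negP => h; apply: nr; exists t.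
  have ex : exists t, r <= A * K ^+ t by exists t0.
  case: (ex_minnP ex) => -[|t] ht hmin.
    by move: ht; rewrite expr0 mulr1 leNgt Ar.
  exists t => //; rewrite ltNge; apply/negP => /hmin; by rewrite ltnn.
have [E [mE QE hE]] := tails t.
apply: (@le_trans _ _ (mu_ext Q E)).
  apply: le_mu_ext => a /= ra; apply: contrapT => /hE h.
  have := le_trans ra h; rewrite lee_fin leNgt => /negP; apply.
  exact: le_lt_trans (hD t) ht1.
rewrite measurable_mu_extE //; apply: le_trans QE _; rewrite lee_fin.
rewrite -{1}(lnK q0) -expRM_natl ler_expR.
have : ln r <= ln A + t.+1%:R * ln K.
  by rewrite mulr_natl -lnXn // -lnM ?posrE ?exprn_gt0 // ler_ln ?posrE // mulr_gt0 ?exprn_gt0.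
rewrite -(ler_pM2l al0) mulrDr.
have -> : al * (t.+1%:R * ln K) = - (t%:R + 1) * ln q.
  by rewrite /al -natr1; field; rewrite gt_eqF.
move=> h; lra.
Qed.

End Tails.

Theorem theorem1p2 (R : realType) (d : nat) (hd : (1 <= d)%N)
  (S : finType) (hS : (0 < #|S|)%N)
  (dO : measure_display) (Om : measurableType dO) (P : probability Om R)
  (X : lattice d -> Om -> S)
  (hX : random_field (@discrete_measurable S) X)
  (hinv : translation_invariant (@discrete_measurable S) P X)
  (hmrf : markov_random_field P X) :
  ((exists delta : R, 0 < delta < 1 /\
      (0 < limn_esup (fun n : nat =>
             (gamma P X (box d (n%:R : R)) (box d (delta * n%:R)))%:E))%E) ->
    ffiid P X) /\
  ((exists delta : R, 0 < delta < 1 /\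
      (0 < limn_einf (fun n : nat =>
             (gamma P X (box d (n%:R : R)) (box d (delta * n%:R)))%:E))%E) ->
    ffiid_power_law P X).
Proof.
have [s0 _] : exists s0 : S, s0 \in S by exact/card_gt0P.
split=> -[delta [d01]]; have [del0 del1] := andP d01.
- move=> /limn_esup_pos[eps eps0 hg].
  pose g N := sval (cid (hg N)).
  have gP N : (N <= g N)%N /\ eps <= gamma P X (box d ((g N)%:R : R)) (box d (delta * (g N)%:R)).
    exact: (svalP (cid (hg N))).
  (* Beyond [2 r / delta], a scale is large enough for the window of radius [r]. *)
  pose ask r := (Num.truncn (r%:R * 2 / delta)).+1.
  pose rad s := iter s (fun r => (r + (g (ask r) + g (ask r) + g (ask r)).+1)%N) 0%N.
  pose n s := g (ask (rad s)).
  have radE s : radius n s = rad s by elim: s => //= s ->.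
  have [||s|q [q01 [dT [T [dO' [Om' [Q [Y [phi [h1 h2 h3]]]]]]]]]] :=
    @coding_of_scales R d S s0 dO Om P X hX hinv hmrf n delta eps d01 eps0.
  + by move=> s; apply: leq_trans (gP _).1.
  + move=> s; rewrite radE; set r := rad s.
    have h : r%:R * 2 / delta <= (n s)%:R.
      apply: le_trans (ltW (truncnS_gt _)) _; rewrite ler_nat; exact: (gP _).1.
    by move: h; rewrite ler_pdivrMr // => h; lra.
  + exact: (gP _).2.
  exists dT, T, dO', Om', Q, Y, phi; split=> //.
  exact: (finitary_of_tails q01 h3).
move=> /limn_einf_pos[eps eps0 [N hg]].
(* The radius is at most [4 n / (K - 1)], hence at most [delta n / 2]. *)
pose K := (Num.truncn (8 / delta)).+2.
pose b := N.+1.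
pose n s := (b * K ^ s)%N.
have K1 : 8 / delta <= K%:R - 1.
  have -> : K%:R = (Num.truncn (8 / delta)).+1%:R + 1 :> R by rewrite natr1.
  by rewrite addrK ltW // truncnS_gt.
have K8 : 8 <= delta * (K%:R - 1) by move: K1; rewrite ler_pdivrMr // mulrC.
have n0 s : (0 < n s)%N by rewrite muln_gt0 /= expn_gt0.
have rn s : (radius n s)%:R * (K%:R - 1) <= 4 * (n s)%:R :> R.
  elim: s => [|s IH]; first by rewrite mul0r mulr_ge0.
  have nS : (n s.+1)%:R = (n s)%:R * K%:R :> R by rewrite /n expnSr mulnA natrM.
  have n1 : 1 <= (n s)%:R :> R by rewrite ler1n.
  have -> : (radius n s.+1)%:R = (radius n s)%:R + ((n s)%:R + (n s)%:R + (n s)%:R + 1) :> R.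
    by rewrite radiusS natrD -[X in _ + X]natr1 !natrD.
  rewrite nS mulrDl.
  have k0 : 0 <= K%:R - 1 :> R by apply: le_trans K1; rewrite divr_ge0 // ltW.
  have : ((n s)%:R + (n s)%:R + (n s)%:R + 1) * (K%:R - 1) <= 4 * (n s)%:R * (K%:R - 1) :> R.
    by rewrite ler_wpM2r //; lra.
  lra.
have hr s : (radius n s)%:R <= delta * (n s)%:R / 2.
  have k0 : 0 < K%:R - 1 :> R by apply: lt_le_trans K1; rewrite divr_gt0.
  rewrite -(ler_pM2r k0); apply: le_trans (rn s) _.
  have : 8 * (n s)%:R <= delta * (K%:R - 1) * (n s)%:R by rewrite ler_wpM2r.
  lra.
have hgn s : eps <= gamma P X (box d ((n s)%:R : R)) (box d (delta * (n s)%:R)).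
  by apply: hg; rewrite /n (leq_trans (leqnSn N)) // leq_pmulr // expn_gt0.
have [q [q01 [dT [T [dO' [Om' [Q [Y [phi [h1 h2 h3]]]]]]]]]] :=
    @coding_of_scales R d S s0 dO Om P X hX hinv hmrf n delta eps d01 eps0 n0 hr hgn.
exists dT, T, dO', Om', Q, Y, phi; split=> //.
- exact: (finitary_of_tails q01 h3).
- apply: (power_law_of_tails q01 h3 (A := (d * b)%:R) (K := K%:R)).
  + by rewrite ler1n muln_gt0 hd.
  + by rewrite ltr1n.
  move=> t; rewrite -natrX -natrM ler_nat -mulnA leq_mul2l; apply/orP; right.
  rewrite -(ler_nat R); apply: le_trans (hr t) _.
  have := n0 t; rewrite -(ltr0n R) => np.
  have : delta * (n t)%:R <= (n t)%:R by rewrite ler_piMl // ltW.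
  rewrite -/(n t); lra.
Qed.
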